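(* Let $-1<\alpha,\beta<1$ and let $\mu$ be a finite positive Borel measure on $[0,1)$. Then, for any $\theta>0$, the operator $\mathbf{H}_{\mu}:\mathcal{F}^{2}_{\theta,\alpha}\rightarrow\mathcal{F}^{2}_{\theta,\beta}$ is compact if and only if $\mu$ is a vanishing $[1+\frac{1}{2}(\beta-\alpha)]$-Carleson measure on $[0,1)$.
   Context: $\mathcal{H}(\mathbb{C})$ denotes the class of all entire functions on $\mathbb{C}$, and $\mathbb{N}_0=\mathbb{N}\cup\{0\}$. For $\theta>0$ and $\alpha\in\mathbb{R}$, the weighted Fock space is $$\mathcal{F}^{2}_{\theta,\alpha}=\Big\{f=\sum_{n=0}^{\infty}a_nz^n\in\mathcal{H}(\mathbb{C}):\ \|f\|_{\theta,\alpha}^2:=\sum_{n=0}^{\infty}(n+\theta)^{\alpha}|a_n|^2\,n!<\infty\Big\}.$$ It is a Hilbert space with inner product $\langle f,g\rangle=\sum_{n=0}^{\infty}(n+\theta)^{\alpha}a_n\overline{b_n}\,n!$ for $f=\sum a_nz^n$, $g=\sum b_nz^n$. Any power series whose coefficients satisfy the summability condition is automatically entire. For a positive Borel measure $\mu$ on $[0,1)$ put $\mu[n]=\int_{[0,1)}t^{n}\,d\mu(t)$ for $n\in\mathbb{N}_0$. For $f=\sum_{k=0}^{\infty}a_kz^k\in\mathcal{H}(\mathbb{C})$, the Hilbert-type operator $\mathbf{H}_{\mu}$ is defined by $$\mathbf{H}_{\mu}(f)(z):=\sum_{n=0}^{\infty}\left(\frac{1}{\sqrt{n!}}\sum_{k=0}^{\infty}\mu[k+n]\,a_k\sqrt{k!}\right)z^n.$$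 Saying that $\mathbf{H}_\mu:\mathcal{F}^{2}_{\theta,\alpha}\to\mathcal{F}^{2}_{\theta,\beta}$ is compact means that it is well defined on $\mathcal{F}^{2}_{\theta,\alpha}$ (the coefficient series converge and the image lies in $\mathcal{F}^{2}_{\theta,\beta}$) and is a compact linear operator between these Hilbert spaces. For $s>0$, a positive Borel measure $\mu$ on $[0,1)$ is an $s$-Carleson measure if there is a constant $C_1>0$ such that $\mu([t,1))\le C_1(1-t)^s$ for all $t\in[0,1)$. An $s$-Carleson measure $\mu$ on $[0,1)$ is a vanishing $s$-Carleson measure if moreover $\lim_{t\to1^-}\frac{\mu([t,1))}{(1-t)^s}=0$. *)

(* Defs.v *)
From HB Require Import structures.
From mathcomp Require Import all_boot all_order all_algebra.
From mathcomp Require Import all_classical all_reals all_analysis.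
From mathcomp Require Import complex.
From mathcomp Require Import ring.

Set Implicit Arguments.
Unset Strict Implicit.
Unset Printing Implicit Defensive.

Import Order.TTheory GRing.Theory Num.Theory.
Import numFieldNormedType.Exports.
Import ComplexField.Normc.

Local Open Scope classical_set_scope.
Local Open Scope complex_scope.
Local Open Scope ring_scope.

(* The analysis library equips abstract numFieldTypes with their own norm
   topology; this transports it to the concrete type R[i]. *)
HB.instance Definition _ (R : realType) := NormedModule.copy R[i] R[i]^o.

Definition is_power_series {K : numFieldType} (a : nat -> K) (f : K -> K) :=
  forall z : K, series (fun n => a n * z ^+ n) @ \oo --> f z.

(* The coefficients of the everywhere convergent power series of f, unique by
   power_series_unique below. The value is junk (the zero sequence) if f has no
   such expansion. *)
HB.lock Definition taylor {K : numFieldType} (f : K -> K) : nat -> K :=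
  xget (fun=> 0) [set a | is_power_series a f].

Section PowerSeries.
Context {K : numFieldType}.
Implicit Types (a b c : nat -> K) (f g : K -> K).

Lemma is_power_series0 : @is_power_series K (fun=> 0) (fun=> 0).
Proof.
move=> z; rewrite (_ : series _ = fun=> 0); first exact: cvg_cst.
by apply/funext => n; rewrite /series /= big1 // => i _; rewrite mul0r.
Qed.

Lemma is_power_seriesZD (k : K) a b f g :
  is_power_series a f -> is_power_series b g ->
  is_power_series (fun n => k * a n + b n) (fun z => k * f z + g z).
Proof.
move=> af bg z.
rewrite (_ : series _ = fun n => k * series (fun n => a n * z ^+ n) n
                          + series (fun n => b n * z ^+ n) n).
  apply: cvgD; last exact: bg.
  by apply: cvgMr; exact: af.
apply/funext => n; rewrite /series /= mulr_sumr -big_split /=.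
by apply: eq_bigr => i _; rewrite mulrDl mulrA.
Qed.

Lemma power_series_coef0 c (M : K) : (forall n, `|c n| <= M) ->
  (forall z, z != 0 -> series (fun n => c n * z ^+ n) @ \oo --> (0 : K)) ->
  c 0%N = 0.
Proof.
move=> cM c0; apply/eqP; apply: contraT => c0N0.
have : 0 < `|c 0%N| by rewrite normr_gt0.
set d := `|c 0%N| => d_gt0.
have M_ge0 : 0 <= M by apply: le_trans (cM 0%N).
have D_gt0 : 0 < M * 2 + d by rewrite ltr_wpDl// mulr_ge0.
pose z := d / 2 / (M * 2 + d).
have z_gt0 : 0 < z by rewrite !divr_gt0.
have z_half : z <= 2^-1.
  by rewrite ler_pdivrMr// mulrC ler_wpM2l ?invr_ge0// lerDr mulr_ge0.
have Mz : M * z * 2 <= d / 2.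
  rewrite mulrAC mulrCA ler_piMr ?divr_ge0 ?ltW// ltr_pdivrMr// mul1r.
  by rewrite ltrDl.
clearbody z.
have geo m : \sum_(0 <= i < m) z ^+ i <= 2.
  have sum_ge0 : 0 <= \sum_(0 <= i < m) z ^+ i.
    by apply: sumr_ge0 => i _; rewrite exprn_ge0 ?ltW.
  have z2 : 2^-1 <= 1 - z.
    rewrite lerBrDr (le_trans (lerD (lexx _) z_half))//.
    by rewrite -[2^-1]mul1r -splitr.
  rewrite -[leRHS]mulr1 mulrC -ler_pdivrMr//.
  apply: le_trans (ler_wpM2l sum_ge0 z2) _.
  by rewrite mulrC -opprB mulNr big_mkord -subrX1 opprB gerBl exprn_ge0 ?ltW.
have bnd N : `|series (fun n => c n * z ^+ n) N.+1 - c 0%N| <= M * z * 2.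
  rewrite /series /= big_nat_recl// expr0 mulr1 addrC addKr.
  apply: le_trans (ler_norm_sum _ _ _) _.
  apply: (@le_trans _ _ (M * z * \sum_(0 <= i < N) z ^+ i)); last first.
    by rewrite ler_wpM2l// mulr_ge0// ltW.
  rewrite mulr_sumr; apply: ler_sum => i _.
  rewrite exprS mulrA !normrM normrX (gtr0_norm z_gt0).
  apply: ler_wpM2r; first by rewrite exprn_ge0 ?ltW.
  by apply: ler_wpM2r; rewrite ?cM ?ltW.
have /cvgrPdist_lt/(_ (d / 2)) : series (fun n => c n * z ^+ n) @ \oo --> (0 : K).
  by apply: c0; rewrite gt_eqF.
rewrite divr_gt0// => /(_ isT)[N _ /(_ N.+1 (leqnSn N))]; rewrite sub0r normrN => hN.
have := le_lt_trans (ler_normB _ _) (ltr_leD hN (le_trans (bnd N) Mz)).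
by rewrite subKr -splitr ltxx.
Qed.

Lemma power_series_unique a b f :
  is_power_series a f -> is_power_series b f -> a = b.
Proof.
move=> af bf.
have := is_power_seriesZD (k := -1) af bf.
set c : nat -> K := fun n => _; move=> cs.
suff c0 n : c n = 0.
  by apply/funext => n; apply/esym/eqP; rewrite -subr_eq0 -(c0 n) /c mulN1r addrC.
have {}cs z : series (fun n => c n * z ^+ n) @ \oo --> (0 : K).
  by have := cs z; rewrite mulN1r addNr.
clearbody c.
have [M cM] : exists M, forall n, `|c n| <= M.
  have /cvg_series_cvg_0/cvgP/cvg_seq_bounded : cvgn (series (fun n => c n * 1 ^+ n)).
    by apply/cvg_ex; exists 0; exact: cs.
  have PF := @globally_properfilter nat setT 0%N I.
  move=> /ex_bound [M /= cM]; exists M => m.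
  by have := cM m I; rewrite expr1n mulr1.
elim: n {-2}n (leqnn n) => [|N IH] n.
  rewrite leqn0 => /eqP ->; apply: (@power_series_coef0 c M) => // z _; exact: cs.
move=> nN; have IH' m : (m < n)%N -> c m = 0.
  by move=> mn; apply: IH; rewrite -ltnS (leq_trans mn).
rewrite -[n in LHS]addn0.
apply: (@power_series_coef0 (fun k => c (n + k)%N) M) => // z z0.
rewrite (_ : series _ = fun k => z ^- n * series (fun n => c n * z ^+ n) (k + n)%N).
  rewrite -[in X in _ --> X](mulr0 (z ^- n)); apply: cvgMr.
  by rewrite (cvg_shiftn n (series _)); exact: cs.
apply/funext => k; rewrite /series /= [in RHS](big_cat_nat _ (n := n)) ?leq_addl//=.
rewrite [X in _ * (X + _)]big1_seq ?add0r; last first.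
  by move=> i; rewrite mem_index_iota => /IH' ->; rewrite mul0r.
rewrite -[X in index_iota X (k + n)]add0n big_addn addnK mulr_sumr.
apply: eq_bigr => i _.
rewrite addnC exprD mulrCA; congr (_ * _).
by rewrite mulrCA mulVf ?mulr1// expf_neq0.
Qed.

Lemma taylorE a f : is_power_series a f -> taylor f = a.
Proof.
move=> af; rewrite taylor.unlock; case: xgetP => [b _ bf|/(_ a)//].
exact: power_series_unique bf af.
Qed.

End PowerSeries.

Definition fock_weight {R : realType} (theta : {posnum R}) (alpha : R)
    (n : nat) : R :=
  (n%:R + theta%:num) `^ alpha * n`!%:R.

(* Locked, like taylor, because unfolding it makes conversion diverge. *)
HB.lock Definition fock_sqnorm {R : realType} (theta : {posnum R}) (alpha : R)
    (a : nat -> R[i]) : \bar R :=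
  (\sum_(0 <= n <oo) (fock_weight theta alpha n * normc (a n) ^+ 2)%:E)%E.

Section Fock.
Context {R : realType}.
Implicit Types (theta : {posnum R}) (alpha : R) (a b : nat -> R[i]).
Implicit Types (f g : R[i] -> R[i]).

(* The base field of the normed module R[i] is R[i] itself, so derivable is
   complex differentiability here. *)
Definition entire f := forall z : R[i], derivable f z 1.

Definition fock_set theta alpha : set (R[i] -> R[i]) :=
  [set f | entire f /\
    exists2 a, is_power_series a f & (fock_sqnorm theta alpha a < +oo)%E].

Lemma normc_ge0 (z : R[i]) : 0 <= normc z.
Proof. by case: z => x y; exact: sqrtr_ge0. Qed.

Lemma fock_weight_gt0 theta alpha n : 0 < fock_weight theta alpha n.
Proof.
by rewrite mulr_gt0 ?powR_gt0 ?ltr_wpDl ?ltr0n ?fact_gt0.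
Qed.

Lemma fock_term_ge0 theta alpha a n :
  0 <= fock_weight theta alpha n * normc (a n) ^+ 2.
Proof. by rewrite mulr_ge0 ?sqr_ge0// ltW// fock_weight_gt0. Qed.

Lemma fock_sqnorm_ge0 theta alpha a : (0 <= fock_sqnorm theta alpha a)%E.
Proof.
rewrite fock_sqnorm.unlock; apply: nneseries_ge0 => n _ _.
by rewrite lee_fin fock_term_ge0.
Qed.

Lemma fock_sqnormZ theta alpha (k : R[i]) a :
  fock_sqnorm theta alpha (fun n => k * a n) =
  ((normc k ^+ 2)%:E * fock_sqnorm theta alpha a)%E.
Proof.
rewrite fock_sqnorm.unlock -nneseriesZl => [|n _]; last first.
  by rewrite lee_fin fock_term_ge0.
apply: eq_eseriesr => n _.
by rewrite -EFinM normcM exprMn mulrCA.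
Qed.

Lemma sqr_convex (t x y : R) : 0 < t -> t < 1 ->
  (x + y) ^+ 2 <= t^-1 * x ^+ 2 + (1 - t)^-1 * y ^+ 2.
Proof.
move=> t0 t1; have s0 : 0 < 1 - t by rewrite subr_gt0.
rewrite -subr_ge0 (_ : _ - _ = ((1 - t) * x - t * y) ^+ 2 / (t * (1 - t))).
  by rewrite divr_ge0 ?sqr_ge0// mulr_ge0 ?ltW.
by field; rewrite !gt_eqF.
Qed.

Lemma sqr_convex_opt (A B x : R) : 0 < A -> 0 < B -> 0 <= x ->
  (forall t, 0 < t -> t < 1 ->
    x ^+ 2 <= t^-1 * A ^+ 2 + (1 - t)^-1 * B ^+ 2) ->
  x <= A + B.
Proof.
move=> A0 B0 x0 xAB; have AB0 : 0 < A + B by exact: addr_gt0.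
have t0 : 0 < A / (A + B) by exact: divr_gt0.
have t1 : A / (A + B) < 1 by rewrite ltr_pdivrMr// mul1r ltrDl.
have := xAB _ t0 t1.
rewrite (_ : 1 - _ = B / (A + B)); last by field; rewrite !gt_eqF.
rewrite (_ : _ + _ = (A + B) ^+ 2); last by field; rewrite !gt_eqF.
by rewrite ler_pXn2r// nnegrE ltW.
Qed.

Lemma fock_sqnormD theta alpha a b (t : R) : 0 < t -> t < 1 ->
  (fock_sqnorm theta alpha (fun n => a n + b n)%R <=
   (t^-1)%:E * fock_sqnorm theta alpha a +
   ((1 - t)^-1)%:E * fock_sqnorm theta alpha b)%E.
Proof.
move=> t0 t1; have s0 : 0 < 1 - t by rewrite subr_gt0.
have ge0 (c : nat -> R[i]) k : 0 < k -> forall n,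
    (0 <= k%:E * (fock_weight theta alpha n * normc (c n) ^+ 2)%:E)%E.
  by move=> k0 n; rewrite -EFinM lee_fin mulr_ge0 ?fock_term_ge0// ltW.
rewrite fock_sqnorm.unlock -!nneseriesZl; try
  by move=> n _; rewrite lee_fin fock_term_ge0.
rewrite -nneseriesD; try by move=> n _ _; apply: ge0; rewrite invr_gt0.
apply: lee_nneseries => [n _ _|n _].
  by rewrite lee_fin (fock_term_ge0 _ _ (fun n => a n + b n)).
rewrite -!EFinM -EFinD lee_fin.
rewrite [t^-1 * _]mulrCA [(1 - t)^-1 * _]mulrCA -mulrDr ler_pM2l ?fock_weight_gt0//.
apply: le_trans (sqr_convex _ _ t0 t1).
by rewrite ler_pXn2r ?nnegrE ?addr_ge0 ?normc_ge0 ?le_normcD.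
Qed.

Definition fock_pred theta alpha : {pred R[i] -> R[i]} :=
  mem (fock_set theta alpha).

Lemma fock_submod_closed theta alpha : submod_closed (fock_pred theta alpha).
Proof.
split=> [|k f g].
  apply: mem_set; split; first by move=> z; exact: derivable_cst.
  exists (fun=> 0); first exact: is_power_series0.
  rewrite fock_sqnorm.unlock eseries0 ?ltry// => n _ _.
  by rewrite normc0 expr0n mulr0.
move=> /set_mem[fe [a af na]] /set_mem[ge [b bg nb]]; apply: mem_set; split.
  move=> z; apply: derivableD; last exact: ge.
  by apply: derivableZ; exact: fe.
exists (fun n => k * a n + b n); first exact: is_power_seriesZD.
have h0 : 0 < 2^-1 :> R by rewrite invr_gt0.
have h1 : 2^-1 < 1 :> R by rewrite invf_lt1// ltr1n.
apply: le_lt_trans (fock_sqnormD _ _ _ _ h0 h1) _.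
rewrite lte_add_pinfty// lte_mul_pinfty ?lee_fin ?invr_ge0 ?subr_ge0 ?ltW//.
by rewrite fock_sqnormZ lte_mul_pinfty ?lee_fin ?sqr_ge0.
Qed.

HB.instance Definition _ theta alpha :=
  GRing.isSubmodClosed.Build _ _ (fock_pred theta alpha)
    (fock_submod_closed theta alpha).

Record fock theta alpha := Fock {
  fock_fun :> R[i] -> R[i];
  _ : fock_fun \in fock_pred theta alpha }.

HB.instance Definition _ theta alpha := [isSub for @fock_fun theta alpha].
HB.instance Definition _ theta alpha := [Choice of fock theta alpha by <:].
HB.instance Definition _ theta alpha :=
  [SubChoice_isSubLmodule of fock theta alpha by <:].

Definition fock_norm theta alpha (f : fock theta alpha) : R :=
  Num.sqrt (fine (fock_sqnorm theta alpha (taylor f))).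

Lemma fock_norm_ge0 theta alpha (f : fock theta alpha) : 0 <= fock_norm f.
Proof. exact: sqrtr_ge0. Qed.

Lemma fock_taylor theta alpha (f : fock theta alpha) :
  is_power_series (taylor f) f /\
  (fock_sqnorm theta alpha (taylor f) < +oo)%E.
Proof.
by case: f => f /= /set_mem[_ [a af na]]; rewrite (taylorE af).
Qed.

Lemma taylor_fockZ theta alpha k (f : fock theta alpha) :
  taylor (k *: f) = fun n => k * taylor f n.
Proof.
apply: taylorE => z.
have := is_power_seriesZD (k := k) (fock_taylor f).1 is_power_series0 (z := z).
by rewrite addr0; under [X in series X]funext do rewrite addr0.
Qed.

Lemma taylor_fockD theta alpha (f g : fock theta alpha) :
  taylor (f + g) = fun n => taylor f n + taylor g n.
Proof.
apply: taylorE => z.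
have := is_power_seriesZD (k := 1) (fock_taylor f).1 (fock_taylor g).1 (z := z).
by rewrite mul1r; under [X in series X]funext do rewrite mul1r.
Qed.

Lemma fock_norm_sqr theta alpha (f : fock theta alpha) :
  fock_sqnorm theta alpha (taylor f) = (fock_norm f ^+ 2)%:E.
Proof.
rewrite sqr_sqrtr ?fine_ge0 ?fock_sqnorm_ge0// fineK// ge0_fin_numE.
  exact: (fock_taylor f).2.
exact: fock_sqnorm_ge0.
Qed.

Lemma fock_norm_eq0 theta alpha (f : fock theta alpha) :
  fock_norm f = 0 -> f = 0.
Proof.
move=> f0; have a0 n : taylor f n = 0.
  have : (\sum_(0 <= i < n.+1)
      (fock_weight theta alpha i * normc (taylor f i) ^+ 2)%:E <= 0)%E.
    have s0 : fock_sqnorm theta alpha (taylor f) = 0%E.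
      by rewrite fock_norm_sqr f0 expr0n.
    rewrite -[X in (_ <= X)%E]s0 fock_sqnorm.unlock.
    by apply: nneseries_lim_ge => i _ _; rewrite lee_fin fock_term_ge0.
  rewrite big_nat_recr//= => h.
  have : (0 + (fock_weight theta alpha n * normc (taylor f n) ^+ 2)%:E <= 0)%E.
    apply: le_trans h; apply: leeD => //.
    by apply: sume_ge0 => i _; rewrite lee_fin fock_term_ge0.
  rewrite add0e lee_fin pmulr_rle0 ?fock_weight_gt0// => h2.
  apply: eq0_normc; apply/eqP; rewrite -sqrf_eq0 eq_le h2.
  exact: sqr_ge0.
apply: val_inj; apply/funext => z /=.
have := (fock_taylor f).1 z.
rewrite (_ : taylor f = fun=> 0); last by apply/funext.
by move/cvg_unique => /(_ (@norm_hausdorff _ _)); apply; exact: is_power_series0.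
Qed.

Lemma fock_normD theta alpha (f g : fock theta alpha) :
  fock_norm (f + g) <= fock_norm f + fock_norm g.
Proof.
have [f0|f0] := eqVneq (fock_norm f) 0.
  by rewrite f0 add0r (fock_norm_eq0 f0) add0r.
have [g0|g0] := eqVneq (fock_norm g) 0.
  by rewrite g0 addr0 (fock_norm_eq0 g0) addr0.
apply: sqr_convex_opt => [|||t t0 t1].
- by rewrite lt_neqAle eq_sym f0; exact: fock_norm_ge0.
- by rewrite lt_neqAle eq_sym g0; exact: fock_norm_ge0.
- exact: fock_norm_ge0.
have := fock_sqnormD theta alpha (taylor f) (taylor g) t0 t1.
by rewrite -taylor_fockD !fock_norm_sqr -!EFinM -EFinD lee_fin.
Qed.

Lemma fock_normZ theta alpha k (f : fock theta alpha) :
  fock_norm (k *: f) = normc k * fock_norm f.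
Proof.
rewrite {1}/fock_norm taylor_fockZ fock_sqnormZ fock_norm_sqr -EFinM /=.
by rewrite -exprMn sqrtr_sqr ger0_norm// mulr_ge0 ?normc_ge0 ?fock_norm_ge0.
Qed.

Definition fock_normC theta alpha (f : fock theta alpha) : R[i] :=
  (fock_norm f)%:C.

Lemma fock_normCD theta alpha (f g : fock theta alpha) :
  fock_normC (f + g) <= fock_normC f + fock_normC g.
Proof. by rewrite -rmorphD lecR fock_normD. Qed.

Lemma fock_normCZ theta alpha (k : R[i]) (f : fock theta alpha) :
  fock_normC (k *: f) = `|k| * fock_normC f.
Proof. by rewrite /fock_normC fock_normZ rmorphM; case: k. Qed.

Lemma fock_normC_eq0 theta alpha (f : fock theta alpha) :
  fock_normC f = 0 -> f = 0.
Proof. by move=> /complexI/fock_norm_eq0. Qed.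

HB.instance Definition _ theta alpha := Lmodule_isNormed.Build R[i]
  (fock theta alpha) (@fock_normCD theta alpha) (@fock_normCZ theta alpha)
  (@fock_normC_eq0 theta alpha).

End Fock.

Definition compact_operator {K : numFieldType} {V W : normedModType K}
    (T : {linear V -> W}) :=
  forall A : set V, bounded_set A -> precompact (T @` A).

Section HilbertOperator.
Context {R : realType}.
Implicit Types (mu : {finite_measure set R -> \bar R}) (a : nat -> R[i]).

Definition moment mu (n : nat) : R := \int[mu]_(t in `[0, 1[) t ^+ n.

Definition hilbert_term mu a (n k : nat) : R[i] :=
  (moment mu (k + n))%:C * a k * (Num.sqrt k`!%:R)%:C.

Definition hilbert_coef mu a (n : nat) : R[i] :=
  (Num.sqrt n`!%:R)^-1%:C * limn (series (hilbert_term mu a n)).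

Definition is_hilbert_image mu (f g : R[i] -> R[i]) :=
  (forall n, cvgn (series (hilbert_term mu (taylor f) n))) /\
  is_power_series (hilbert_coef mu (taylor f)) g.

Definition hilbert_compact mu (theta : {posnum R}) (alpha beta : R) :=
  exists T : {linear fock theta alpha -> fock theta beta},
    (forall f : fock theta alpha, is_hilbert_image mu f (T f)) /\
    compact_operator T.

Definition carleson mu (s : R) :=
  exists2 C1 : R, 0 < C1 &
    forall t : R, 0 <= t < 1 -> (mu `[t, 1%R[%classic <= (C1 * (1 - t) `^ s)%:E)%E.

Definition vanishing_carleson mu (s : R) :=
  carleson mu s /\
  fine (mu `[t, 1%R[%classic) / (1 - t) `^ s @[t --> 1^'-] --> 0.

End HilbertOperator.

(* Main.v *)
From HB Require Import structures.
Require Import Defs.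
From mathcomp Require Import all_boot all_order all_algebra.
From mathcomp Require Import all_classical all_reals all_analysis.
From mathcomp Require Import complex.
From mathcomp Require Import ring lra zify.

Set Implicit Arguments.
Unset Strict Implicit.
Unset Printing Implicit Defensive.

Import Order.TTheory GRing.Theory Num.Theory.
Import numFieldNormedType.Exports.
Import ComplexField.Normc.

Local Open Scope classical_set_scope.
Local Open Scope ring_scope.

(** Let s = 1 + (beta - alpha) / 2, which lies in ]0, 2[, and let m_n be the
    moments of mu. Both sides of the equivalence are compared with the condition
    m_n = o(n^-s), called moment_decay below.

    The vanishing Carleson condition is equivalent to this decay. In one
    direction t^n is dominated by a step function with exponentially small jumps
    located at distance about j/n from 1 (exprn_le_step); in the other,
    mu([t, 1[) is at most exp(2) m_n for n = floor(1/(1-t)) (tail_le_moment).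

    In the bases of normalized monomials the operator has the matrix
    (n+theta)^(beta/2) m_(n+k) (k+theta)^(-alpha/2). If m_i <= C (i+1)^-s for
    i >= L, its rows of index n >= L are bounded by a homogeneous kernel of degree
    -1, for which Schur's test with the weight (n+1)^(-1/2) applies precisely
    because alpha and beta lie in ]-1, 1[ (hilbert_inequality). Hence the operator
    is bounded, and under moment_decay the image of a bounded set has uniformly
    small tails. Such a set is relatively compact (compact_fock_tails).

    Conversely the coefficients of a compact set have uniformly small tails
    (compact_uniform_tails). The image of the unit vector with coordinates
    N^(-1/2) on [N, 2N[ has on the same block [N, 2N[ a mass of at least a
    constant times (m_(4N) N^s)^2, so that compactness forces m_n = o(n^-s). *)

(** * Power sums and Schur's test *)

Section RealInequalities.
Context {R : realType}.
Implicit Types (x y p q r s : R).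

(** Powers of comparable positive numbers are comparable, whatever the sign of
    the exponent g. *)
Lemma powR_le_of_ratio (lo hi g : R) : 0 < lo -> 0 < hi ->
  exists2 D : R, 0 < D & forall x y, 0 < x -> 0 < y ->
    lo * y <= x -> x <= hi * y -> x `^ g <= D * y `^ g.
Proof.
move=> lo0 hi0; exists (lo `^ g + hi `^ g).
  by rewrite addr_gt0// powR_gt0.
move=> x y x0 y0 lx xh.
have loy : 0 < lo * y by rewrite mulr_gt0.
have hiy : 0 < hi * y by rewrite mulr_gt0.
rewrite mulrDl -(powRM _ (ltW lo0) (ltW y0)) -(powRM _ (ltW hi0) (ltW y0)).
have [g0|g0] := leP 0 g.
  apply: (@le_trans _ _ ((hi * y) `^ g)); last by rewrite lerDr powR_ge0.
  by apply: ge0_ler_powR => //; rewrite ?nnegrE ltW.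
apply: (@le_trans _ _ ((lo * y) `^ g)); last by rewrite lerDl powR_ge0.
rewrite -[g]opprK !(powRN _ (- g)) lef_pV2 ?posrE ?powR_gt0//.
by apply: ge0_ler_powR => //; rewrite ?nnegrE ?oppr_ge0 ltW.
Qed.

Lemma expRN_le (x : R) : 0 <= x -> x <= 1 -> expR (- x) <= 1 - x / 2.
Proof.
move=> x0 x1; rewrite expRN.
have h : 1 + x <= expR x := expR_ge1Dx x.
apply: (@le_trans _ _ (1 + x)^-1).
  by rewrite lef_pV2 ?posrE ?expR_gt0//; lra.
rewrite -[leLHS]mul1r ler_pdivrMr; nra.
Qed.

Lemma powR_1sub_le (a u : R) : 0 < a -> a <= 1 -> 0 < u -> u <= 1 ->
  (1 - u) `^ a <= 1 - a * u / 2.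
Proof.
move=> a0 a1 u0 u1; have [->|u1'] := eqVneq u 1.
  by rewrite subrr powR0 ?gt_eqF//; lra.
have v0 : 0 < 1 - u by rewrite subr_gt0 lt_neqAle u1' u1.
rewrite /powR gt_eqF//; apply: le_trans (expRN_le _ _); last 2 first.
- by rewrite mulr_ge0 ?ltW.
- nra.
rewrite ler_expR -mulrN ler_pM2l//; apply: le_ln1Dx; lra.
Qed.

Lemma powR_1sub_ge (r u : R) : 0 < r -> 0 < u -> u < 1 ->
  1 + r * u <= (1 - u) `^ (- r).
Proof.
move=> r0 u0 u1; have v0 : 0 < 1 - u by rewrite subr_gt0.
rewrite /powR gt_eqF//; apply: le_trans (expR_ge1Dx _); rewrite lerD2l.
rewrite mulNr -mulrN ler_pM2l// lerNr; apply: le_ln1Dx; lra.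
Qed.

(** By induction: the increment (n+1)^(1-p) - n^(1-p) dominates (n+1)^-p up to
    the factor (1-p)/2. *)
Lemma sum_powR_le (p : R) (n : nat) : 0 < p < 1 ->
  \sum_(0 <= k < n) k.+1%:R `^ (- p) <= 2 / (1 - p) * n%:R `^ (1 - p).
Proof.
move=> /andP[p0 p1]; have a0 : 0 < 1 - p by rewrite subr_gt0.
elim: n => [|n IH]; first by rewrite big_geq // mulr_ge0 ?powR_ge0 // divr_ge0 ?ltW.
rewrite big_nat_recr//=; apply: le_trans (lerD IH (lexx _)) _.
have n0 : 0 < n.+1%:R :> R by rewrite ltr0n.
set a := 1 - p in a0 *.
have -> : n.+1%:R `^ (- p) = n.+1%:R `^ a * n.+1%:R^-1.
  rewrite -(powR_inv1 (ltW n0)) -powRD; last by rewrite (gt_eqF n0) implybT.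
  by congr (_ `^ _); rewrite /a; lra.
have -> : n%:R = n.+1%:R * (1 - n.+1%:R^-1) :> R.
  by rewrite mulrBr mulr1 mulfV ?gt_eqF// -natr1 addrK.
have u1 : n.+1%:R^-1 <= 1 :> R by rewrite invf_le1// ler1n.
rewrite powRM ?subr_ge0//.
rewrite mulrCA [leRHS]mulrC -mulrDr ler_wpM2l ?powR_ge0//.
have a1 : a <= 1 by rewrite /a; lra.
have ui : 0 < n.+1%:R^-1 :> R by rewrite invr_gt0.
have := powR_1sub_le a0 a1 ui u1.
set v := (1 - _) `^ a; set w := _^-1 => vle.
have -> : w = 2 / a * (a * w / 2) by field; rewrite gt_eqF.
rewrite -mulrDr -[leRHS]mulr1 ler_wpM2l ?divr_ge0 ?(ltW a0)//; lra.
Qed.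

Lemma sum_powR_tail_le (r : R) (n M : nat) : 0 < r -> (0 < n)%N ->
  \sum_(n <= k < M) k.+1%:R `^ (- (r + 1)) <= r^-1 * n%:R `^ (- r).
Proof.
move=> r0 n0; have [nM|Mn] := leqP n M; last first.
  by rewrite big_geq ?(ltnW Mn)// mulr_ge0 ?powR_ge0// invr_ge0 ltW.
suff : \sum_(n <= k < M) k.+1%:R `^ (- (r + 1)) <=
    r^-1 * (n%:R `^ (- r) - M%:R `^ (- r)).
  move=> /le_trans; apply; rewrite ler_wpM2l ?invr_ge0 ?(ltW r0)//.
  by rewrite gerBl powR_ge0.
elim: M nM => [|M IH]; first by rewrite leqn0 gt_eqF.
rewrite leq_eqVlt => /predU1P[<-|]; first by rewrite big_geq// subrr mulr0.
rewrite ltnS => nM; rewrite big_nat_recr//=.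
apply: le_trans (lerD (IH nM) (lexx _)) _.
have M0 : (0 < M)%N by apply: leq_trans nM.
have M10 : 0 < M.+1%:R :> R by rewrite ltr0n.
have u0 : 0 < M.+1%:R^-1 :> R by rewrite invr_gt0.
have u1 : M.+1%:R^-1 < 1 :> R by rewrite invf_lt1// ltr1n.
have := powR_1sub_ge r0 u0 u1.
have -> : M%:R = M.+1%:R * (1 - M.+1%:R^-1) :> R.
  by rewrite mulrBr mulr1 mulfV ?gt_eqF// -natr1 addrK.
have -> : M.+1%:R `^ (- (r + 1)) = M.+1%:R `^ (- r) * M.+1%:R^-1.
  by rewrite opprD powRD ?(powR_inv1 (ltW M10))// (gt_eqF M10) implybT.
rewrite powRM ?subr_ge0//; last exact: ltW.
set v := (1 - _) `^ _; set w := _^-1; set z := M.+1%:R `^ _ => h.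
have z0 : 0 <= z by exact: powR_ge0.
have -> : r^-1 * (n%:R `^ (- r) - z * v) + z * w =
   r^-1 * (n%:R `^ (- r) - z * (v - r * w)) by field; rewrite gt_eqF.
rewrite ler_wpM2l ?invr_ge0 ?(ltW r0)// lerD2l lerN2 -[leLHS]mulr1 ler_wpM2l//.
lra.
Qed.

(** The Hilbert-type sum: both the part k <= n and the tail k > n are of the
    order (n+1)^(1-p-q), by comparison with power sums. *)
Lemma sum_hilbert_le (p q : R) (n N : nat) : 0 < p < 1 -> 0 < q -> 1 < p + q ->
  \sum_(0 <= k < N) k.+1%:R `^ (- p) * (n + k).+1%:R `^ (- q) <=
  (2 / (1 - p) + (p + q - 1)^-1) * n.+1%:R `^ (1 - p - q).
Proof.
move=> p01 q0 pq1; have [p0 p1] := andP p01.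
apply: (@le_trans _ _ (\sum_(0 <= k < n.+1 + N)
    k.+1%:R `^ (- p) * (n + k).+1%:R `^ (- q))).
  rewrite [leRHS](big_cat_nat _ (n := N)) ?leq_addl//= lerDl.
  by apply: sumr_ge0 => i _; rewrite mulr_ge0 ?powR_ge0.
have powN x y : 0 < x -> x <= y -> y `^ (- q) <= x `^ (- q) :> R.
  move=> x0 xy; have y0 : 0 < y by apply: lt_le_trans xy.
  rewrite !powRN lef_pV2 ?posrE ?powR_gt0//.
  by apply: ge0_ler_powR => //; rewrite ?nnegrE ltW.
rewrite (big_cat_nat _ (n := n.+1)) ?leq_addr//= mulrDl; apply: lerD.
  apply: (@le_trans _ _ (\sum_(0 <= k < n.+1) k.+1%:R `^ (- p) *
      n.+1%:R `^ (- q))).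
    apply: ler_sum => k _; rewrite ler_wpM2l ?powR_ge0// powN ?ltr0n//.
    by rewrite ler_nat ltnS leq_addr.
  rewrite -mulr_suml powRD; last by rewrite pnatr_eq0 implybT.
  by rewrite mulrA ler_wpM2r ?powR_ge0// sum_powR_le.
have r0 : 0 < p + q - 1 by rewrite subr_gt0.
apply: (@le_trans _ _ (\sum_(n.+1 <= k < n.+1 + N)
    k.+1%:R `^ (- (p + q - 1 + 1)))).
  apply: ler_sum => k _; rewrite subrK opprD powRD; last first.
    by rewrite pnatr_eq0 implybT.
  by rewrite ler_wpM2l ?powR_ge0// powN ?ltr0n// ler_nat ltnS leq_addl.
have -> : 1 - p - q = - (p + q - 1) by ring.
exact: sum_powR_tail_le.
Qed.

(** Schur's test for a finite nonnegative matrix, with the same weight on the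
    rows and on the columns. *)
Lemma schur_test (H : nat -> nat -> R) (w x : nat -> R) (B : R) (m M N : nat) :
  0 < B -> (forall n k, 0 <= H n k) -> (forall n, 0 < w n) ->
  (forall n, \sum_(0 <= k < N) H n k * w k <= B * w n) ->
  (forall k, \sum_(m <= n < M) H n k * w n <= B * w k) ->
  \sum_(m <= n < M) (\sum_(0 <= k < N) H n k * x k) ^+ 2 <=
  B ^+ 2 * \sum_(0 <= k < N) x k ^+ 2.
Proof.
move=> B0 H0 w0 Hrow Hcol.
set y := fun n => \sum_(0 <= k < N) H n k * x k.
set Y := \sum_(m <= n < M) y n ^+ 2; set X := \sum_(0 <= k < N) x k ^+ 2.
rewrite -[leLHS]/Y.
(* With y = H x, the square y_n^2 = sum_k H_nk y_n x_k is bounded using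
   2 y_n x_k <= (w_k / (B w_n)) y_n^2 + (B w_n / w_k) x_k^2; the first part
   sums to at most Y by the row condition and is absorbed on the left. *)
have : Y * 2 <= Y + B ^+ 2 * X; last by lra.
pose F n k := H n k * (B^-1 * y n ^+ 2 * w k / w n).
pose G n k := H n k * (B * x k ^+ 2 * w n / w k).
apply: (@le_trans _ _ (\sum_(m <= n < M) \sum_(0 <= k < N) (F n k + G n k))).
  rewrite /Y mulr_suml; apply: ler_sum => n _.
  rewrite expr2 {2}/y mulr_sumr mulr_suml; apply: ler_sum => k _.
  rewrite /F /G -mulrDr.
  have -> : y n * (H n k * x k) * 2 = H n k * (y n * x k * 2) by ring.
  rewrite ler_wpM2l//.
  rewrite -subr_ge0.
  have -> : B^-1 * y n ^+ 2 * w k / w n + B * x k ^+ 2 * w n / w k -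
      y n * x k * 2 = (B * w n * w k)^-1 * (y n * w k - B * x k * w n) ^+ 2.
    by field; rewrite !gt_eqF.
  by rewrite mulr_ge0 ?sqr_ge0// invr_ge0 !mulr_ge0 ?ltW.
under eq_bigr do rewrite big_split /=.
rewrite big_split /=; apply: lerD.
  apply: ler_sum => n _.
  have -> : \sum_(0 <= k < N) F n k =
      B^-1 * y n ^+ 2 / w n * \sum_(0 <= k < N) H n k * w k.
    by rewrite mulr_sumr; apply: eq_bigr => k _; rewrite /F; ring.
  apply: le_trans (ler_wpM2l _ (Hrow n)) _.
    by rewrite divr_ge0 ?(ltW (w0 _))// mulr_ge0 ?sqr_ge0 ?invr_ge0// ltW.
  by rewrite le_eqVlt; apply/orP; left; apply/eqP; field; rewrite !gt_eqF.
rewrite exchange_big /= /X mulr_sumr; apply: ler_sum => k _.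
have -> : \sum_(m <= n < M) G n k =
    B * x k ^+ 2 / w k * \sum_(m <= n < M) H n k * w n.
  by rewrite mulr_sumr; apply: eq_bigr => n _; rewrite /G; ring.
apply: le_trans (ler_wpM2l _ (Hcol k)) _.
  by rewrite divr_ge0 ?(ltW (w0 _))// mulr_ge0 ?sqr_ge0 ?invr_ge0// ltW.
by rewrite le_eqVlt; apply/orP; left; apply/eqP; field; rewrite !gt_eqF.
Qed.
End RealInequalities.

(** * The discrete Hilbert inequality *)

Section HilbertInequality.
Context {R : realType}.
Variables (alpha beta : R) (theta : {posnum R}).
Hypotheses (alpha1 : -1 < alpha < 1) (beta1 : -1 < beta < 1).

Let range : [/\ -1 < alpha, alpha < 1, -1 < beta & beta < 1].
Proof. by case/andP: alpha1; case/andP: beta1. Qed.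

Let s := 1 + (beta - alpha) / 2.

(** The shift theta only changes the weights by a bounded factor. *)
Lemma succ_powR_equiv (g : R) : exists2 D : R, 0 < D & forall n : nat,
  (n%:R + theta%:num) `^ g <= D * n.+1%:R `^ g.
Proof.
have t0 : 0 < theta%:num by [].
have lo0 : 0 < Num.min theta%:num 1 by rewrite lt_min t0 ltr01.
have hi0 : 0 < Num.max theta%:num 1 by rewrite lt_max t0.
have [D D0 HD] := powR_le_of_ratio g lo0 hi0.
exists D => // n; apply: HD.
- by rewrite ltr_wpDl.
- by rewrite ltr0n.
- rewrite -natr1 mulrDr mulr1 lerD//; last by rewrite ge_min lexx.
  by rewrite ler_piMl// ge_min lexx orbT.
- rewrite -natr1 mulrDr mulr1 lerD//; last by rewrite le_max lexx.
  by rewrite ler_peMl// le_max lexx orbT.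
Qed.

(* The kernel to which Schur's test is applied has degree -1; the weight is the
   classical (n+1)^(-1/2). *)
Let H (n k : nat) : R :=
  n.+1%:R `^ (beta / 2) * (k.+1%:R `^ (- (alpha / 2)) * (n + k).+1%:R `^ (- s)).
Let w (n : nat) : R := n.+1%:R `^ (- 2^-1).

Let H_row : exists2 B : R, 0 < B & forall n N,
  \sum_(0 <= k < N) H n k * w k <= B * w n.
Proof.
have [a1 a2 b1 b2] := range.
set p := (1 + alpha) / 2.
have p01 : 0 < p < 1 by rewrite /p; lra.
have s0 : 0 < s by rewrite /s; lra.
have ps1 : 1 < p + s by rewrite /p /s; lra.
exists (2 / (1 - p) + (p + s - 1)^-1).
  have [/andP[_ p1] q1] := (p01, ps1).
  by rewrite addr_gt0 ?divr_gt0 ?invr_gt0 ?subr_gt0.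
move=> n N; have h := sum_hilbert_le n N p01 s0 ps1.
have n0 : n.+1%:R != 0 :> R by rewrite pnatr_eq0.
have -> : w n = n.+1%:R `^ (beta / 2) * n.+1%:R `^ (1 - p - s).
  rewrite -powRD ?n0 ?implybT//; congr (_ `^ _).
  by rewrite /p /s; field.
rewrite mulrCA; apply: le_trans (ler_wpM2l (powR_ge0 _ _) h).
rewrite mulr_sumr; apply: ler_sum => k _.
rewrite /H /w -!mulrA ler_wpM2l ?powR_ge0//.
rewrite mulrCA [leRHS]mulrC ler_wpM2l ?powR_ge0//.
rewrite -powRD; last by rewrite pnatr_eq0 implybT.
by rewrite (_ : - (alpha / 2) + - 2^-1 = - p)//; rewrite /p; field.
Qed.

Let H_col : exists2 B : R, 0 < B & forall m M k,
  \sum_(m <= n < M) H n k * w n <= B * w k.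
Proof.
have [a1 a2 b1 b2] := range.
set p := (1 - beta) / 2.
have p01 : 0 < p < 1 by rewrite /p; lra.
have s0 : 0 < s by rewrite /s; lra.
have ps1 : 1 < p + s by rewrite /p /s; lra.
exists (2 / (1 - p) + (p + s - 1)^-1).
  have [/andP[_ p1] q1] := (p01, ps1).
  by rewrite addr_gt0 ?divr_gt0 ?invr_gt0 ?subr_gt0.
move=> m M n; have h := sum_hilbert_le n M p01 s0 ps1.
have n0 : n.+1%:R != 0 :> R by rewrite pnatr_eq0.
have -> : w n = n.+1%:R `^ (- (alpha / 2)) * n.+1%:R `^ (1 - p - s).
  rewrite -powRD ?n0 ?implybT//; congr (_ `^ _).
  by rewrite /p /s; field.
rewrite mulrCA; apply: le_trans (ler_wpM2l (powR_ge0 _ _) h).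
have Hw k : H k n * w k = n.+1%:R `^ (- (alpha / 2)) *
    (k.+1%:R `^ (- p) * (n + k).+1%:R `^ (- s)).
  have -> : - p = beta / 2 + - 2^-1 by rewrite /p; field.
  rewrite powRD; last by rewrite pnatr_eq0 implybT.
  by rewrite /H /w addnC; ring.
rewrite mulr_sumr; under eq_bigr do rewrite Hw.
have F0 k : 0 <= n.+1%:R `^ (- (alpha / 2)) *
    (k.+1%:R `^ (- p) * (n + k).+1%:R `^ (- s)) :> R.
  by rewrite !mulr_ge0 ?powR_ge0.
have [mM|Mm] := leqP m M; last first.
  by rewrite big_geq ?(ltnW Mm)//; apply: sumr_ge0.
by rewrite [leRHS](big_cat_nat _ (n := m))//= lerDr; apply: sumr_ge0.
Qed.

(** The discrete Hilbert inequality behind the boundedness of the operator.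
    Only the rows n >= L are summed and the size of the moments is only used
    there, so that decaying moments give small tails. *)
Lemma hilbert_inequality : exists2 B : R, 0 < B &
  forall (m : nat -> R) (C : R) (L : nat), 0 <= C -> (forall i, 0 <= m i) ->
    (forall i, (L <= i)%N -> m i <= C * i.+1%:R `^ (- (1 + (beta - alpha) / 2))) ->
  forall (M N : nat) (x : nat -> R), (forall k, 0 <= x k) ->
  \sum_(L <= n < M) (n%:R + theta%:num) `^ beta *
    (\sum_(0 <= k < N) m (k + n)%N * (k%:R + theta%:num) `^ (- (alpha / 2)) * x k)
      ^+ 2 <= (C * B) ^+ 2 * \sum_(0 <= k < N) x k ^+ 2.
Proof.
have [D D0 HD] := succ_powR_equiv beta.
have [E E0 HE] := succ_powR_equiv (- (alpha / 2)).
have [B1 B10 HB1] := H_row; have [B2 B20 HB2] := H_col.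
pose B0 := B1 + B2; have B00 : 0 < B0 by rewrite addr_gt0.
exists ((1 + D) * E * B0); first by rewrite !mulr_gt0// addr_gt0.
move=> m C L C0 m0 mC M N x x0.
have w0 n : 0 < w n by rewrite powR_gt0.
have := @schur_test R H w x B0 L M N B00 _ w0 _ _.
have H0 n k : 0 <= H n k by rewrite !mulr_ge0 ?powR_ge0.
have Hr n : \sum_(0 <= k < N) H n k * w k <= B0 * w n.
  by apply: le_trans (HB1 _ _) _; rewrite ler_pM2r// /B0 lerDl ltW.
have Hc k : \sum_(L <= n < M) H n k * w n <= B0 * w k.
  by apply: le_trans (HB2 _ _ _) _; rewrite ler_pM2r// /B0 lerDr ltW.
move=> /(_ H0 Hr Hc) hS.
have -> : (C * ((1 + D) * E * B0)) ^+ 2 = (C * (1 + D) * E) ^+ 2 * B0 ^+ 2.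
  by ring.
rewrite -mulrA; apply: le_trans (ler_wpM2l (sqr_ge0 _) hS).
rewrite mulr_sumr !big_nat; apply: ler_sum => n /andP[Ln _].
set S := \sum_(0 <= k < N) H n k * x k.
set T := \sum_(0 <= k < N) _.
have TS : n.+1%:R `^ (beta / 2) * T <= C * E * S.
  rewrite /T /S !mulr_sumr; apply: ler_sum => k _.
  rewrite /H !mulrA ler_wpM2r//.
  have -> : C * E * n.+1%:R `^ (beta / 2) * k.+1%:R `^ (- (alpha / 2)) *
      (n + k).+1%:R `^ (- s) = n.+1%:R `^ (beta / 2) *
      ((C * (n + k).+1%:R `^ (- s)) * (E * k.+1%:R `^ (- (alpha / 2)))) by ring.
  rewrite -mulrA ler_wpM2l ?powR_ge0// ler_pM ?powR_ge0//.
  by rewrite addnC mC// (leq_trans Ln)// leq_addr.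
have T0 : 0 <= T.
  by apply: sumr_ge0 => k _; rewrite !mulr_ge0 ?powR_ge0.
have S0 : 0 <= S by apply: sumr_ge0 => k _; rewrite mulr_ge0.
apply: (@le_trans _ _ (D * (n.+1%:R `^ (beta / 2) * T) ^+ 2)).
  rewrite exprMn [leRHS]mulrA ler_wpM2r ?sqr_ge0//.
  have -> : (n.+1%:R `^ (beta / 2)) ^+ 2 = n.+1%:R `^ beta :> R.
    rewrite expr2 -powRD; last by rewrite pnatr_eq0 implybT.
    by rewrite -splitr.
  exact: HD.
apply: (@le_trans _ _ (D * (C * E * S) ^+ 2)).
  rewrite (ler_pM2l D0) ler_pXn2r// nnegrE.
    by rewrite mulr_ge0 ?powR_ge0.
  by rewrite !mulr_ge0// ltW.
have -> : (C * (1 + D) * E) ^+ 2 * S ^+ 2 = (1 + D) ^+ 2 * (C * E * S) ^+ 2.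
  by ring.
by rewrite ler_wpM2r ?sqr_ge0//; nra.
Qed.

End HilbertInequality.

(** * Moments and tails of a measure on the unit interval *)

Section Moments.
Context {R : realType} (mu : {finite_measure set R -> \bar R}).
Local Notation G t := (fine (mu `[t, 1%R[%classic)).

Lemma fine_tailK (t : R) : (G t)%:E = mu `[t, 1%R[%classic.
Proof. by rewrite fineK// fin_num_measure. Qed.

Lemma integrable_exprn (n : nat) :
  mu.-integrable `[0, 1[%classic (EFin \o (fun t : R => t ^+ n)).
Proof.
apply: measurable_bounded_integrable => //.
- by rewrite ltey_eq fin_num_measure.
exists 1; split => // M M1 t /=; rewrite in_itv/= => /andP[t0 t1].
apply: le_trans (ltW M1); rewrite ger0_norm ?exprn_ge0//.
by rewrite exprn_ile1// ltW.
Qed.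

Lemma moment_ge0 n : 0 <= moment mu n.
Proof.
apply: Rintegral_ge0 => t /=; rewrite in_itv/= => /andP[t0 _].
exact: exprn_ge0.
Qed.

Lemma moment_le m n : (m <= n)%N -> moment mu n <= moment mu m.
Proof.
move=> mn; apply: le_Rintegral => //; try exact: integrable_exprn.
move=> t /=; rewrite in_itv/= => /andP[t0 t1].
by rewrite ler_wiXn2l// ltW.
Qed.

Lemma indic_integrable t :
  mu.-integrable `[0, 1[%classic (EFin \o (\1_(`[t, 1[%classic) : R -> R)).
Proof.
apply: (@integrableS _ _ _ _ setT) => //.
by apply: integrable_indic.
Qed.

Lemma Rintegral_tail t : 0 <= t ->
  \int[mu]_(x in `[0, 1[) (\1_(`[t, 1[%classic) x : R) = G t.
Proof.
move=> t0; rewrite /Rintegral integral_indic// setIidl//.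
by move=> x /=; rewrite !in_itv/= => /andP[tx ->]; rewrite (le_trans t0 tx).
Qed.

Lemma moment_ge_tail n t : 0 <= t -> t ^+ n * G t <= moment mu n.
Proof.
move=> t0; rewrite -Rintegral_tail// -RintegralZl//; last exact: indic_integrable.
apply: le_Rintegral => //; last 2 first.
- exact: integrable_exprn.
- move=> x /=; rewrite in_itv/= => /andP[x0 x1].
  rewrite indicE; case: (boolP (x \in _)); last by rewrite mulr0 exprn_ge0.
  rewrite inE/= in_itv/= => /andP[tx _]; rewrite mulr1.
  by rewrite lerXn2r// nnegrE.
exact: (integrableZl _ (t ^+ n) (indic_integrable t)).
Qed.

Lemma moment_le_step n (c : R) (N : nat) (e r : nat -> R) :
  (forall j, 0 <= r j) ->
  (forall t, 0 <= t < 1 ->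
     t ^+ n <= c + \sum_(0 <= j < N) e j * \1_(`[r j, 1[%classic) t) ->
  moment mu n <= c * G 0 + \sum_(0 <= j < N) e j * G (r j).
Proof.
move=> r0 h.
pose F K := fun t : R => c + \sum_(0 <= j < K) e j * \1_(`[r j, 1[%classic) t.
have [hI hE] : mu.-integrable `[0, 1[%classic (EFin \o F N) /\
    \int[mu]_(t in `[0, 1[) F N t = c * G 0 + \sum_(0 <= j < N) e j * G (r j).
  elim: N {h} => [|N [IH1 IH2]].
    have -> : F 0%N = cst c.
      by apply/funext => t; rewrite /F big_geq// addr0.
    rewrite big_geq// addr0 Rintegral_cst//; split=> //.
    exact: finite_measure_integrable_cst.
  have IZ : mu.-integrable `[0, 1[%classic
      (EFin \o (fun t : R => e N * \1_(`[r N, 1[%classic) t)).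
    exact: (integrableZl _ (e N) (indic_integrable (r N))).
  have -> : F N.+1 = fun t => F N t + e N * \1_(`[r N, 1[%classic) t.
    by apply/funext => t; rewrite /F big_nat_recr//= addrA.
  split; first exact: (integrableD _ IH1 IZ).
  rewrite RintegralD// IH2 big_nat_recr//= addrA; congr (_ + _).
  by rewrite RintegralZl// ?Rintegral_tail//; exact: indic_integrable.
by rewrite -hE; apply: le_Rintegral => //; exact: integrable_exprn.
Qed.

End Moments.

(** * Vanishing Carleson measures and decay of the moments *)

Section MomentDecay.
Context {R : realType}.
Implicit Types (s x t : R) (mu : {finite_measure set R -> \bar R}).

(** The moments are o(n^-s); the index is shifted by one to keep the power away
    from 0. *)
Definition moment_decay mu s := forall e : R, 0 < e ->
  exists L : nat, forall n, (L <= n)%N -> moment mu n <= e * n.+1%:R `^ (- s).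

Lemma moment_decay_bound mu s : 0 < s -> moment_decay mu s ->
  exists2 C : R, 0 < C & forall n, moment mu n <= C * n.+1%:R `^ (- s).
Proof.
move=> s0 /(_ 1 ltr01)[L HL].
have C0 : 0 <= moment mu 0 * L.+1%:R `^ s by rewrite mulr_ge0 ?moment_ge0 ?powR_ge0.
exists (1 + moment mu 0 * L.+1%:R `^ s); first by rewrite ltr_wpDr.
move=> n; have [Ln|nL] := leqP L n.
  by apply: le_trans (HL n Ln) _; rewrite ler_wpM2r ?powR_ge0// lerDl.
apply: le_trans (moment_le mu (leq0n n)) _.
apply: (@le_trans _ _ (moment mu 0 * L.+1%:R `^ s * n.+1%:R `^ (- s))).
  rewrite -mulrA ler_peMr ?moment_ge0//.
  rewrite powRN ler_pdivlMr ?powR_gt0// mul1r.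
  by apply: ge0_ler_powR; rewrite ?nnegrE ?(ltW s0)// ler_nat ltnS ltnW.
by rewrite ler_wpM2r ?powR_ge0// lerDr.
Qed.

Lemma expR_ge_exprn (k : nat) (x : R) : 0 <= x ->
  (1 + x / k.+1%:R) ^+ k.+1 <= expR x.
Proof.
move=> x0.
have -> : expR x = expR (x / k.+1%:R) ^+ k.+1.
  by rewrite -expRM_natr -mulrA mulVf ?mulr1// pnatr_eq0.
rewrite lerXn2r ?nnegrE ?expR_ge0 ?expR_ge1Dx//.
by rewrite addr_ge0// divr_ge0.
Qed.

Lemma sum_expRN_bounded : exists2 K : R, 0 < K &
  forall N : nat, \sum_(0 <= j < N) expR (- j%:R) * j.+1%:R ^+ 2 <= K.
Proof.
(* exp(-j) <= 4^4 / (j+1)^4, and the remaining series of 1/(j+1)^2 telescopes;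
   the constant is made opaque to keep numerals out of the computation. *)
have : 0 < 4 ^+ 4 :> R by rewrite exprn_gt0.
have := erefl (4 ^+ 4 : R); move: {2 3}(4 ^+ 4 : R) => c cE c0.
have c20 : 0 < c * 2 by rewrite mulr_gt0.
exists (c * 2) => // N.
suff : \sum_(0 <= j < N) expR (- j%:R) * j.+1%:R ^+ 2 <= c * 2 - c * 2 / N.+1%:R.
  by move/le_trans; apply; rewrite gerBl divr_ge0 ?ler0n ?(ltW c20).
elim: N => [|N IH]; first by rewrite big_geq// divr1 subrr.
rewrite big_nat_recr//=; apply: le_trans (lerD IH (lexx _)) _.
set y : R := N.+1%:R.
have y1 : 1 <= y by rewrite ler1n.
have -> : N.+2%:R = y + 1 :> R by rewrite natr1.
have h : expR (- N%:R) <= c / y ^+ 4.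
  rewrite expRN -[leRHS]invrK lef_pV2 ?posrE ?expR_gt0 ?invr_gt0 ?divr_gt0//;
    last by rewrite exprn_gt0//; lra.
  apply: le_trans (expR_ge_exprn 3 _); last by [].
  have -> : (c / y ^+ 4)^-1 = (y / 4) ^+ 4 by rewrite -cE; field; lra.
  have y40 : 0 <= y / 4 by lra.
  rewrite lerXn2r ?nnegrE// ?addr_ge0 ?divr_ge0//.
  by rewrite /y -natr1 mulrDl mul1r addrC lerD2r invf_le1// ler1n.
apply: le_trans (lerD (lexx _) (ler_wpM2r (sqr_ge0 _) h)) _.
rewrite -subr_ge0.
have -> : c * 2 - c * 2 / (y + 1) - (c * 2 - c * 2 / y + c / y ^+ 4 * y ^+ 2) =
   c * (y - 1) / (y ^+ 2 * (y + 1)) by field; lra.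
have y0 : 0 <= y by lra.
by rewrite divr_ge0 ?mulr_ge0 ?exprn_ge0 ?subr_ge0 ?addr_ge0 ?(ltW c0).
Qed.

Lemma powR_le_sqr (y s : R) : 1 <= y -> s <= 2 -> y `^ s <= y ^+ 2.
Proof.
move=> y1 s2; rewrite -powR_mulrn; last by lra.
by apply: ler_powR.
Qed.

(** Pointwise domination of a power of t by a constant plus a step function; its
    jump of index j has size exp(-j) and lies at distance
    min ((j+1)/(n+1)) d from 1. *)
Lemma exprn_le_step (n : nat) (d t : R) : 0 <= d <= 1 -> 0 <= t < 1 ->
  t ^+ n.+1 <= (1 - d) ^+ n.+1 + \sum_(0 <= j < n.+2)
    expR (- j%:R) * \1_(`[Num.max (1 - j.+1%:R / n.+1%:R) (1 - d), 1[%classic) t.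
Proof.
move=> /andP[d0 d1] /andP[t0 t1].
have S0 j : 0 <= expR (- j%:R) *
    \1_(`[Num.max (1 - j.+1%:R / n.+1%:R) (1 - d), 1[%classic) t :> R.
  by rewrite mulr_ge0 ?expR_ge0.
have [td|dt] := ltP t (1 - d).
  apply: (@le_trans _ _ ((1 - d) ^+ n.+1)).
    by rewrite lerXn2r ?nnegrE// ?subr_ge0// ltW.
  by rewrite lerDl; apply: sumr_ge0.
have n0 : 0 < n.+1%:R :> R by rewrite ltr0n.
(* The jump of index floor((n+1)(1-t)) alone dominates t^(n+1). *)
pose j := Num.truncn (n.+1%:R * (1 - t)).
have u0 : 0 <= n.+1%:R * (1 - t) by rewrite mulr_ge0// subr_ge0 ltW.
have /andP[j1 j2] := truncn_itv u0.
have jn : (j < n.+2)%N.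
  rewrite ltnS -(ler_nat R); apply: le_trans j1 _.
  by rewrite ler_piMr ?(ltW n0)//; lra.
apply: (@le_trans _ _ (expR (- j%:R) *
    \1_(`[Num.max (1 - j.+1%:R / n.+1%:R) (1 - d), 1[%classic) t)); last first.
  rewrite big_mkord (bigD1 (Ordinal jn))//= addrCA lerDl.
  by rewrite addr_ge0 ?exprn_ge0 ?subr_ge0//; apply: sumr_ge0.
rewrite indicE mem_set ?mulr1; last first.
  rewrite /= in_itv/= t1 andbT ge_max dt andbT.
  rewrite lerBlDr -lerBlDl ler_pdivlMr// mulrC; exact: ltW.
apply: (@le_trans _ _ (expR (- (1 - t)) ^+ n.+1)).
  rewrite lerXn2r ?nnegrE ?expR_ge0//.
  by apply: le_trans (expR_ge1Dx _); lra.
by rewrite -expRM_natr ler_expR mulNr lerN2 mulrC.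
Qed.

(** Integrating the step function of exprn_le_step: the constant part decays
    exponentially, and the jumps only see tails mu([r, 1[) with r close to 1. *)
Lemma vanishing_carleson_moment_decay mu s : 0 < s -> s <= 2 ->
  vanishing_carleson mu s -> moment_decay mu s.
Proof.
move=> s0 s2 [_ hv] e e0.
have [K K0 sumK] := sum_expRN_bounded.
pose eta := e / (K * 8).
have eta0 : 0 < eta by rewrite divr_gt0// mulr_gt0.
have [d d01 Hd] : exists2 d : R, 0 < d < 1 & forall t, 1 - d <= t -> t < 1 ->
    fine (mu `[t, 1%R[%classic) <= eta * (1 - t) `^ s.
  move/cvgr0_norm_le : hv => /(_ _ eta0)[r /= r0 Hr].
  exists (Num.min (r / 2) 2^-1).
    by rewrite lt_min divr_gt0//= invr_gt0 ltr0n/= gt_min invf_lt1// ltr1n orbT.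
  move=> t dt t1.
  have u0 : 0 < (1 - t) `^ s by apply: powR_gt0; rewrite subr_gt0.
  rewrite -ler_pdivrMr//; apply: le_trans (ler_norm _) _; apply: Hr => //=.
  rewrite ger0_norm; last by lra.
  have : Num.min (r / 2) 2^-1 <= r / 2 by rewrite ge_min lexx.
  by lra.
have [d0 d1] := andP d01.
pose G0 := fine (mu `[0, 1%R[%classic).
have G00 : 0 <= G0 by exact: fine_ge0.
pose L := Num.truncn (54 * G0 / (d ^+ 3 * e)).
exists L.+1 => n' Ln'; case: n' Ln' => // n Ln.
have n0 : 0 < n.+1%:R :> R by rewrite ltr0n.
have d01' : 0 <= d <= 1 by rewrite !ltW.
have r0 j : 0 <= Num.max (1 - j.+1%:R / n.+1%:R) (1 - d).
  by rewrite le_max; apply/orP; right; lra.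
apply: le_trans (moment_le_step mu r0 (fun t => exprn_le_step n (t := t) d01')) _.
rewrite -/G0 (splitr e) mulrDl; apply: lerD.
  (* (1-d)^(n+1) <= exp(-d(n+1)) <= 27 / (d (n+2))^3, and (n+2)^s <= (n+2)^2. *)
  have p0 : 0 < n.+2%:R `^ s :> R by rewrite powR_gt0.
  rewrite powRN ler_pdivlMr// -mulrA.
  set y : R := n.+2%:R.
  have y0 : 0 < y by rewrite ltr0n.
  have h1 : y `^ s <= y ^+ 2 by rewrite powR_le_sqr// ler1n.
  have h2 : (1 - d) ^+ n.+1 <= 27 / (d ^+ 3 * y ^+ 3).
    apply: (@le_trans _ _ (expR (- (d * n.+1%:R)))).
      rewrite -mulNr expRM_natr lerXn2r ?nnegrE ?expR_ge0//; first by lra.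
      by apply: le_trans (expR_ge1Dx _); lra.
    have dn0 : 0 <= d * n.+1%:R by rewrite mulr_ge0// ltW.
    have q0 : 0 < 27 / (d ^+ 3 * y ^+ 3) by rewrite divr_gt0// mulr_gt0 ?exprn_gt0.
    rewrite expRN -[leRHS]invrK lef_pV2 ?posrE ?expR_gt0 ?invr_gt0//.
    apply: le_trans (expR_ge_exprn 2 dn0).
    have -> : (27 / (d ^+ 3 * y ^+ 3))^-1 = (d * y / 3) ^+ 3 by field; lra.
    rewrite lerXn2r ?nnegrE// ?(addr_ge0 ler01 (divr_ge0 dn0 _))//.
      by rewrite divr_ge0// mulr_ge0// ltW.
    by rewrite /y -natr1; lra.
  have h3 : 54 * G0 <= y * (d ^+ 3 * e).
    rewrite -ler_pdivrMr ?mulr_gt0 ?exprn_gt0//.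
    have q0 : 0 <= 54 * G0 / (d ^+ 3 * e).
      by rewrite divr_ge0 ?mulr_ge0// ?exprn_ge0// ltW.
    have /andP[_ /ltW] := truncn_itv q0; move/le_trans; apply.
    by rewrite ler_nat -/L; apply: leq_trans Ln _.
  have d30 : 0 < d ^+ 3 by rewrite exprn_gt0.
  apply: le_trans (ler_pM _ _ h2 (ler_wpM2l G00 h1)) _.
  - by rewrite exprn_ge0//; lra.
  - by rewrite mulr_ge0// powR_ge0.
  have -> : 27 / (d ^+ 3 * y ^+ 3) * (G0 * y ^+ 2) =
      54 * G0 / (y * d ^+ 3) / 2 by field; lra.
  rewrite ler_pM2r// ler_pdivrMr ?mulr_gt0//.
  by rewrite (_ : e * (y * d ^+ 3) = y * (d ^+ 3 * e))//; ring.
apply: (@le_trans _ _ (\sum_(0 <= j < n.+2)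
    eta * n.+1%:R `^ (- s) * (expR (- j%:R) * j.+1%:R ^+ 2))).
  apply: ler_sum => j _.
  have -> : eta * n.+1%:R `^ (- s) * (expR (- j%:R) * j.+1%:R ^+ 2) =
    expR (- j%:R) * (eta * (n.+1%:R `^ (- s) * j.+1%:R ^+ 2)) by ring.
  rewrite ler_wpM2l ?expR_ge0//.
  have j0 : 0 < j.+1%:R / n.+1%:R :> R by rewrite divr_gt0.
  apply: le_trans (Hd _ _ _) _.
  - by rewrite le_max lexx orbT.
  - by rewrite gt_max !gtrBl j0 d0.
  rewrite ler_pM2l//.
  apply: (@le_trans _ _ ((j.+1%:R / n.+1%:R) `^ s)).
    apply: ge0_ler_powR; rewrite ?nnegrE ?(ltW s0) ?(ltW j0)//.
      by rewrite subr_ge0 ge_max !gerBl !ltW.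
    by rewrite lerBlDr -lerBlDl le_max lexx.
  rewrite powRM ?invr_ge0// mulrC -powR_inv1// -powRrM mulN1r.
  by rewrite ler_wpM2l ?powR_ge0// powR_le_sqr// ler1n.
rewrite -mulr_sumr.
apply: le_trans (ler_wpM2l _ (sumK _)) _.
  by rewrite mulr_ge0 ?powR_ge0 ?(ltW eta0).
have h : n.+1%:R `^ (- s) <= 4 * n.+2%:R `^ (- s) :> R.
  rewrite !powRN ler_pdivlMr ?powR_gt0// mulrC ler_pdivrMr ?powR_gt0//.
  apply: (@le_trans _ _ (2 `^ s * n.+1%:R `^ s)).
    rewrite -powRM//; apply: ge0_ler_powR; rewrite ?nnegrE ?(ltW s0)//.
    by rewrite -natr1 [leRHS]mulrC mulr_natr mulr2n lerD2l ler1n.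
  rewrite ler_wpM2r ?powR_ge0//; apply: le_trans (powR_le_sqr _ s2) _.
    by rewrite ler1n.
  by rewrite expr2 -natrM.
rewrite mulrAC; apply: le_trans (ler_wpM2l _ h) _; first by rewrite mulr_ge0 ?ltW.
by rewrite /eta le_eqVlt; apply/orP; left; apply/eqP; field; rewrite gt_eqF.
Qed.

(** For n = floor(1/(1-t)), the power t^n stays above exp(-2) on [t, 1[. *)
Lemma tail_le_moment mu t : 2^-1 <= t < 1 ->
  exists n : nat, (1 - t)^-1 < n.+1%:R /\
    fine (mu `[t, 1%R[%classic) <= expR 2 * moment mu n.
Proof.
move=> /andP[t2 t1].
have u0 : 0 < 1 - t by rewrite subr_gt0.
have v0 : 0 <= (1 - t)^-1 by rewrite invr_ge0 ltW.
exists (Num.truncn (1 - t)^-1).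
have /andP[n1 n2] := truncn_itv v0; split=> //.
set n := Num.truncn _ in n1 n2 *.
have t0 : 0 <= t by lra.
have tt : 0 < t by lra.
have G0 : 0 <= fine (mu `[t, 1%R[%classic) by exact: fine_ge0.
rewrite mulrC -ler_pdivrMr ?expR_gt0//; apply: le_trans (moment_ge_tail mu n t0).
rewrite mulrC ler_wpM2r// -expRN.
apply: (@le_trans _ _ (expR (- (2 * (1 - t))) ^+ n)).
  rewrite -expRM_natr ler_expR mulNr lerN2.
  have n1' : n%:R * (1 - t) <= 1 by rewrite -ler_pdivlMr// mul1r.
  by rewrite -mulrA [X in 2 * X]mulrC; nra.
rewrite lerXn2r ?nnegrE ?expR_ge0//.
rewrite expRN -[leRHS]invrK lef_pV2 ?posrE ?expR_gt0 ?invr_gt0//.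
apply: le_trans (expR_ge1Dx _).
by rewrite -[leLHS]mul1r ler_pdivrMr//; nra.
Qed.

Lemma moment_decay_vanishing_carleson mu s : 0 < s -> s <= 2 ->
  moment_decay mu s -> vanishing_carleson mu s.
Proof.
move=> s0 s2 hd.
have tail_le e t n : 0 < e -> t < 1 -> (1 - t)^-1 < n.+1%:R ->
    fine (mu `[t, 1%R[%classic) <= expR 2 * moment mu n ->
    moment mu n <= e * n.+1%:R `^ (- s) ->
    fine (mu `[t, 1%R[%classic) <= expR 2 * e * (1 - t) `^ s.
  move=> e0 t1 tn h1 h2; apply: le_trans h1 _.
  rewrite -mulrA ler_pM2l ?expR_gt0//; apply: le_trans h2 _.
  rewrite ler_pM2l// powRN invf_ple ?posrE ?powR_gt0 ?subr_gt0//.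
  have u0 : 0 < 1 - t by rewrite subr_gt0.
  have -> : ((1 - t) `^ s)^-1 = (1 - t)^-1 `^ s.
    by rewrite -[in RHS]powR_inv1 ?(ltW u0)// -powRrM mulN1r powRN.
  by apply: ge0_ler_powR; rewrite ?nnegrE ?invr_ge0 ?(ltW s0) ?(ltW u0)// ltW.
split.
  have [C C0 HC] := moment_decay_bound s0 hd.
  pose G0 := fine (mu `[0, 1%R[%classic).
  have G00 : 0 <= G0 by exact: fine_ge0.
  have C10 : 0 < expR 2 * C by rewrite mulr_gt0 ?expR_gt0.
  exists (expR 2 * C + 4 * G0); first by rewrite ltr_wpDr// mulr_ge0.
  move=> t /andP[t0 t1]; rewrite -fine_tailK lee_fin.
  have P0 : 0 <= (1 - t) `^ s by exact: powR_ge0.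
  have [t2|t2] := ltP t 2^-1; last first.
    have /tail_le_moment-/(_ mu)[n [n1 n2]] : 2^-1 <= t < 1 by rewrite t2.
    apply: le_trans (tail_le _ _ _ C0 t1 n1 n2 (HC n)) _.
    by rewrite ler_wpM2r// lerDl mulr_ge0.
  apply: (@le_trans _ _ G0).
    rewrite -lee_fin !fine_tailK le_measure ?inE//.
    by move=> x /=; rewrite !in_itv/= => /andP[tx ->]; rewrite (le_trans t0 tx).
  apply: (@le_trans _ _ (4 * G0 * (1 - t) `^ s)); last first.
    by rewrite ler_wpM2r// lerDr ltW.
  rewrite mulrAC ler_peMl// -ler_pdivrMl// mulr1.
  apply: (@le_trans _ _ ((1 - t) `^ 2)).
    rewrite powR_mulrn; last by lra.
    apply: (@le_trans _ _ (2^-1 ^+ 2)); first by lra.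
    by rewrite lerXn2r ?nnegrE//; lra.
  by apply: ger_powR => //; lra.
apply/cvgr0Pnorm_le => e e0.
have e20 : 0 < e / expR 2 by rewrite divr_gt0 ?expR_gt0.
have [L HL] := hd _ e20.
exists (Num.min 2^-1 L.+1%:R^-1) => /=.
  by rewrite lt_min !invr_gt0 !ltr0n.
move=> t /= dt t1.
have u0 : 0 < 1 - t by rewrite subr_gt0.
rewrite ger0_norm ?(ltW u0)// lt_min in dt; case/andP: dt => dt1 dt2.
rewrite ger0_norm; last by rewrite divr_ge0 ?powR_ge0 ?fine_ge0.
rewrite ler_pdivrMr ?powR_gt0//.
have /tail_le_moment-/(_ mu)[n [n1 n2]] : 2^-1 <= t < 1.
  by apply/andP; split=> //; lra.
have Ln : (L <= n)%N.
  rewrite -ltnS -(ltr_nat R); apply: lt_trans n1.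
  apply: (@lt_trans _ _ L.+1%:R); first by rewrite ltr_nat.
  by rewrite -[ltLHS]invrK ltf_pV2 ?posrE ?invr_gt0 ?ltr0n.
have := tail_le _ _ _ e20 t1 n1 n2 (HL n Ln).
by rewrite mulrCA divff ?mulr1// gt_eqF ?expR_gt0.
Qed.

End MomentDecay.

(** * Complex limits and series *)

Section ComplexLimits.
Local Open Scope complex_scope.
Context {R : realType}.
Implicit Types (z l : R[i]).

Lemma normrc z : `|z| = (normc z)%:C.
Proof. by case: z. Qed.

Lemma normcBC z l : normc (z - l) = normc (l - z).
Proof. by rewrite -normcN opprB. Qed.

Lemma normc_real (x : R) : 0 <= x -> normc x%:C = x.
Proof. by move=> x0; rewrite /= expr0n addr0 sqrtr_sqr ger0_norm. Qed.

Lemma normcX z n : normc (z ^+ n) = normc z ^+ n.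
Proof. by elim: n => [|n IH]; rewrite ?expr0 ?normc1// !exprS normcM IH. Qed.

Lemma normc_nat n : normc (n%:R : R[i]) = n%:R.
Proof. by rewrite normcMn normc1. Qed.

Lemma normc_eq0 z : (normc z == 0) = (z == 0).
Proof.
apply/idP/idP => [/eqP/eq0_normc/eqP//|/eqP ->]; by rewrite normc0.
Qed.

Lemma ler_normc_sum (u : nat -> R[i]) m n :
  normc (\sum_(m <= i < n) u i) <= \sum_(m <= i < n) normc (u i).
Proof.
elim/big_ind2 : _ => [|x y x' y' xy xy'|//]; first by rewrite normc0.
by apply: le_trans (le_normcD _ _) _; apply: lerD.
Qed.

Lemma Re_le_normc z : `|complex.Re z| <= normc z.
Proof. by case: z => x y /=; rewrite -sqrtr_sqr ler_wsqrtr// lerDl sqr_ge0. Qed.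

Lemma Im_le_normc z : `|complex.Im z| <= normc z.
Proof. by case: z => x y /=; rewrite -sqrtr_sqr ler_wsqrtr// lerDr sqr_ge0. Qed.

Lemma normc_le_ReIm z : normc z <= `|complex.Re z| + `|complex.Im z|.
Proof.
case: z => x y /=.
rewrite -[leRHS]ger0_norm ?addr_ge0// -sqrtr_sqr ler_wsqrtr//.
rewrite sqrrD !real_normK ?num_real// -addrA lerD2l lerDr.
by rewrite mulrn_wge0// mulr_ge0.
Qed.

(** The norm of R[i] takes its values in R[i]; this brings the epsilons back to
    R. *)
Lemma cvgc_normcP {T} {F : set_system T} {FF : Filter F} (f : T -> R[i]) l :
  f @ F --> l <->
  forall e : R, 0 < e -> \forall t \near F, normc (l - f t) < e.
Proof.
split=> [/cvgrPdist_lt h e e0|h].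
  have /h : 0 < e%:C by rewrite ltcR.
  by apply: filterS => t; rewrite normrc ltcR.
apply/cvgrPdist_lt => e; rewrite ltcE => /andP[/eqP ei e0].
have := h _ e0; apply: filterS => t te.
have -> : e = (complex.Re e)%:C by case: e ei {e0 te} => a b /= ->.
by rewrite normrc ltcR.
Qed.

Lemma cvgc_ReIm {T} {F : set_system T} {FF : Filter F} (f : T -> R[i]) (x y : R) :
  (fun t => complex.Re (f t)) @ F --> x ->
  (fun t => complex.Im (f t)) @ F --> y -> f @ F --> (x +i* y)%C.
Proof.
move=> /cvgrPdist_lt hx /cvgrPdist_lt hy; apply/cvgc_normcP => e e0.
have e20 : 0 < e / 2 by rewrite divr_gt0.
near=> t; apply: le_lt_trans (normc_le_ReIm _) _; rewrite (splitr e).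
have -> : complex.Re ((x +i* y)%C - f t) = x - complex.Re (f t) by case: (f t).
have -> : complex.Im ((x +i* y)%C - f t) = y - complex.Im (f t) by case: (f t).
by apply: ltrD; near: t; [exact: hx|exact: hy].
Unshelve. all: by end_near. Qed.

Lemma cvgc_normc {T} {F : set_system T} {FF : Filter F} (f : T -> R[i]) l :
  f @ F --> l -> (fun t => normc (f t)) @ F --> normc l.
Proof.
move=> /cvgc_normcP h; apply/cvgrPdist_lt => e e0.
apply: filterS (h _ e0) => t; apply: le_lt_trans.
rewrite ler_norml lerBlDr; apply/andP; split.
  rewrite lerBrDr -lerBrDl opprK normcBC.
  by apply: le_trans (le_normcD _ _); rewrite addrC subrK.
by apply: le_trans (le_normcD _ _); rewrite subrK.
Qed.

Lemma cvgc_normc_le {T} {F : set_system T} {FF : ProperFilter F}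
    (f : T -> R[i]) l (B : R) : f @ F --> l ->
  (\forall t \near F, normc (f t) <= B) -> normc l <= B.
Proof.
move=> /cvgc_normcP h hB; apply/ler_addgt0Pr => e e0.
have [t [h1 h2]] := filter_ex (filterI (h _ e0) hB).
rewrite -(subrK (f t) l) addrC; apply: le_trans (le_normcD _ _) _.
by apply: lerD => //; exact: ltW.
Qed.

(** Absolutely summable complex series converge. *)
Lemma cvgc_abs_series (u : nat -> R[i]) (B : R) :
  (forall N, \sum_(0 <= n < N) normc (u n) <= B) -> cvgn (series u).
Proof.
move=> uB.
have real_cvg (v : nat -> R) : (forall n, `|v n| <= normc (u n)) -> cvgn (series v).
  move=> vu; apply: normed_cvg; rewrite /= ; apply: nondecreasing_is_cvgn.
    by apply: nondecreasing_series => n _ _ /=.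
  exists B => _ [N _ <-]; apply: le_trans (uB N); apply: ler_sum => i _; exact: vu.
have /cvg_ex[x xP] := real_cvg _ (fun n => Re_le_normc (u n)).
have /cvg_ex[y yP] := real_cvg _ (fun n => Im_le_normc (u n)).
apply/cvg_ex; exists (x +i* y)%C; apply: cvgc_ReIm.
- rewrite (_ : (fun t => _) = series (fun n => complex.Re (u n)))//.
  by apply/funext => N; rewrite /series /= raddf_sum.
- rewrite (_ : (fun t => _) = series (fun n => complex.Im (u n)))//.
  by apply/funext => N; rewrite /series /= raddf_sum.
Qed.

End ComplexLimits.

(** * Entire functions from power series *)

Section EntireSeries.
Local Open Scope complex_scope.
Context {R : realType}.
Implicit Types (a : nat -> R[i]) (z h : R[i]).

(** The error of the first order expansion of z^n. *)
Lemma exprD_taylor1 z h n :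
  normc ((z + h) ^+ n - z ^+ n - n%:R * z ^+ n.-1 * h) <=
  n%:R ^+ 2 * (normc z + normc h + 1) ^+ n * normc h ^+ 2.
Proof.
set r := normc z + normc h + 1.
have r1 : 1 <= r by rewrite lerDr addr_ge0 ?normc_ge0.
have r0 : 0 <= r by apply: le_trans r1.
have zr : normc z <= r by rewrite /r -addrA lerDl addr_ge0 ?normc_ge0.
elim: n => [|n IH].
  by rewrite !expr0 subrr mulr0n !mul0r subr0 normc0 expr0n /= !mul0r.
have -> : (z + h) ^+ n.+1 - z ^+ n.+1 - n.+1%:R * z ^+ n.+1.-1 * h =
  (z + h) * ((z + h) ^+ n - z ^+ n - n%:R * z ^+ n.-1 * h) +
  n%:R * z ^+ n.-1 * h ^+ 2.
  case: n {IH} => [|n] /=; rewrite -?natr1 ?exprS ?expr0; ring.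
apply: le_trans (le_normcD _ _) _.
have zh : normc (z + h) <= r.
  by apply: le_trans (le_normcD _ _) _; rewrite /r lerDl.
rewrite !normcM !normcX normc_nat.
apply: (@le_trans _ _ (r * (n%:R ^+ 2 * r ^+ n * normc h ^+ 2) +
    n%:R * r ^+ n.+1 * normc h ^+ 2)).
  apply: lerD; first by rewrite ler_pM ?normc_ge0.
  rewrite ler_wpM2r ?sqr_ge0// ler_wpM2l//.
  apply: (@le_trans _ _ (r ^+ n.-1)).
    by rewrite lerXn2r ?nnegrE ?normc_ge0.
  by rewrite ler_weXn2l// (leq_trans (leq_pred n)).
have -> : r * (n%:R ^+ 2 * r ^+ n * normc h ^+ 2) +
    n%:R * r ^+ n.+1 * normc h ^+ 2 =
    (n%:R ^+ 2 + n%:R) * r ^+ n.+1 * normc h ^+ 2 by rewrite (exprS r n); ring.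
rewrite ler_wpM2r ?sqr_ge0// ler_wpM2r ?exprn_ge0//.
rewrite -natr1; have : 0 <= n%:R :> R by []. 
by set x := n%:R; nra.
Qed.

(** An everywhere absolutely convergent power series is entire: by exprD_taylor1
    its difference quotients converge to the derived series. *)
Lemma entire_power_series a :
  (forall r : R, 0 <= r -> exists B : R, forall N,
     \sum_(0 <= n < N) normc (a n) * r ^+ n <= B) ->
  exists2 f : R[i] -> R[i], is_power_series a f & entire f.
Proof.
move=> ha.
have cvga z : cvgn (series (fun n => a n * z ^+ n)).
  have [B HB] := ha _ (normc_ge0 z); apply: (@cvgc_abs_series _ _ B) => N.
  by under eq_bigr do rewrite normcM normcX; exact: HB.
pose f z := limn (series (fun n => a n * z ^+ n)).
have fP : is_power_series a f by move=> z; exact: cvga.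
exists f; [exact: fP|move=> z].
(* The factors n and n^2 of the derived series and of the error term are
   absorbed by 4^n, and |z| + |h| + 1 <= |z| + 2 for |h| <= 1. *)
set r := 4 * (normc z + 2).
have z20 : 0 <= normc z + 2 by rewrite addr_ge0 ?normc_ge0.
have r0 : 0 <= r by rewrite mulr_ge0.
have [B HB] := ha r r0.
have n2 n : n%:R ^+ 2 <= 4 ^+ n :> R.
  have -> : 4 = 2 ^+ 2 :> R by rewrite expr2 -natrM.
  rewrite -exprM mulnC exprM lerXn2r ?nnegrE//.
  by rewrite -natrX ler_nat ltnW// ltn_expl.
have n1 n : n%:R <= 4 ^+ n :> R.
  apply: le_trans (n2 n); rewrite -natrX ler_nat.
  by case: n => // n; rewrite leq_pmulr.
have [g gP] : exists g : R[i], series (fun n => a n * (n%:R * z ^+ n.-1)) @ \oo --> g.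
  apply/cvg_ex; apply: (@cvgc_abs_series _ _ B) => N.
  apply: le_trans (HB N); apply: ler_sum => n _.
  rewrite !normcM normcX normc_nat ler_wpM2l ?normc_ge0// /r exprMn.
  rewrite ler_pM ?exprn_ge0 ?normc_ge0//.
  apply: (@le_trans _ _ ((normc z + 2) ^+ n.-1)).
    by rewrite lerXn2r ?nnegrE ?normc_ge0// lerDl.
  rewrite ler_weXn2l ?leq_pred//.
  by apply: le_trans (lerD (normc_ge0 z) (lexx _)); rewrite add0r ler1n.
have key h : normc h <= 1 ->
    normc (f (h + z) - f z - g * h) <= B * normc h ^+ 2.
  move=> h1.
  have : (fun N => series (fun n => a n * (h + z) ^+ n) N -
      series (fun n => a n * z ^+ n) N -
      series (fun n => a n * (n%:R * z ^+ n.-1)) N * h) @ \oo -->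
      f (h + z) - f z - g * h.
    apply: cvgB; first by apply: cvgB; [exact: fP|exact: fP].
    by apply: cvgMl; exact: gP.
  move/cvgc_normc_le; apply; apply: nearW => N.
  rewrite /series /= mulr_suml -!sumrB.
  apply: le_trans (ler_normc_sum _ _ _) _.
  apply: le_trans (ler_wpM2r (sqr_ge0 _) (HB N)); rewrite mulr_suml.
  apply: ler_sum => n _.
  have -> : a n * (h + z) ^+ n - a n * z ^+ n - a n * (n%:R * z ^+ n.-1) * h =
    a n * ((z + h) ^+ n - z ^+ n - n%:R * z ^+ n.-1 * h).
    by rewrite [z + h]addrC; ring.
  rewrite normcM -[leRHS]mulrA ler_wpM2l ?normc_ge0//.
  apply: le_trans (exprD_taylor1 _ _ _) _.
  rewrite ler_wpM2r ?sqr_ge0// /r exprMn ler_pM ?sqr_ge0 ?exprn_ge0//.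
    by rewrite !addr_ge0 ?normc_ge0.
  rewrite lerXn2r ?nnegrE ?addr_ge0 ?normc_ge0//.
  by rewrite -addrA lerD2l; lra.
have B0 : 0 <= B by have := HB 0%N; rewrite big_geq.
apply/cvg_ex; exists g; apply/cvgc_normcP => e e0.
have near0 (s : R) : 0 < s -> \forall h \near (0 : R[i])^', h != 0 /\ normc h < s.
  move=> s0; have : \forall h \near nbhs (0 : R[i]), normc h < s.
    have /cvgc_normcP/(_ _ s0) : (id : R[i] -> R[i]) @ nbhs (0 : R[i]) --> (0 : R[i]).
      exact: cvg_id.
    by apply: filterS => h; rewrite sub0r normcN.
  by rewrite near_withinE; apply: filterS => h hs h0.
have /near0 : 0 < Num.min 1 (e / (B + 1)).
  by rewrite lt_min ltr01 divr_gt0// ltr_wpDl.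
apply: filterS => h [h0]; rewrite lt_min => /andP[/ltW h1 hB].
rewrite /= [h *: 1]mulr1 /shift /=.
have -> : g - h^-1 *: (f (h + z) - f z) = - h^-1 * (f (h + z) - f z - g * h).
  by rewrite -[h^-1 *: _]/(h^-1 * _); field.
have hn0 : 0 < normc h by rewrite lt_neqAle eq_sym normc_eq0 h0 normc_ge0.
rewrite normcM normcN normcV mulrC ltr_pdivrMr//.
apply: le_lt_trans (key _ h1) _.
rewrite expr2 mulrA ltr_pM2r//.
rewrite ltr_pdivlMr ?ltr_wpDl// in hB.
by apply: le_lt_trans hB; rewrite mulrC ler_wpM2l ?normc_ge0// lerDl.
Qed.

End EntireSeries.

(** * Coefficients of functions in the Fock space *)

Section FockCoefficients.
Local Open Scope complex_scope.
Context {R : realType}.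
Implicit Types (theta : {posnum R}) (alpha c : R) (a : nat -> R[i]).

Lemma fock_sqnorm_leP theta alpha a c :
  (fock_sqnorm theta alpha a <= c%:E)%E <->
  forall N, \sum_(0 <= n < N) fock_weight theta alpha n * normc (a n) ^+ 2 <= c.
Proof.
rewrite fock_sqnorm.unlock; split=> [h N|h].
  rewrite -lee_fin -sumEFin; apply: le_trans h; apply: nneseries_lim_ge => n _ _.
  by rewrite lee_fin fock_term_ge0.
apply: lime_le.
  by apply: is_cvg_nneseries => n _ _; rewrite lee_fin fock_term_ge0.
by apply: nearW => N; rewrite sumEFin lee_fin.
Qed.

Lemma fock_norm_le theta alpha (f : fock theta alpha) c : 0 <= c ->
  (forall N, \sum_(0 <= n < N)
    fock_weight theta alpha n * normc (taylor f n) ^+ 2 <= c ^+ 2) ->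
  fock_norm f <= c.
Proof.
move=> c0 /fock_sqnorm_leP; rewrite fock_norm_sqr lee_fin.
by rewrite ler_pXn2r// nnegrE fock_norm_ge0.
Qed.

Lemma fock_norm_ge theta alpha (f : fock theta alpha) N :
  \sum_(0 <= n < N) fock_weight theta alpha n * normc (taylor f n) ^+ 2 <=
  fock_norm f ^+ 2.
Proof. by move: N; apply/fock_sqnorm_leP; rewrite fock_norm_sqr. Qed.

Lemma fock_coef_le theta alpha (f : fock theta alpha) n :
  Num.sqrt (fock_weight theta alpha n) * normc (taylor f n) <= fock_norm f.
Proof.
have w0 := fock_weight_gt0 theta alpha n.
rewrite -(@ler_pXn2r _ 2)// ?nnegrE ?fock_norm_ge0 ?mulr_ge0 ?sqrtr_ge0 ?normc_ge0//.
rewrite exprMn sqr_sqrtr ?(ltW w0)//; apply: le_trans (fock_norm_ge f n.+1).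
rewrite big_nat_recr//= lerDr; apply: sumr_ge0 => i _; exact: fock_term_ge0.
Qed.

Lemma sum_exprn_fact_le (x : R) N : 0 <= x ->
  \sum_(0 <= n < N) x ^+ n / n`!%:R <= expR x.
Proof.
move=> x0; apply: (@nondecreasing_cvgn_le _ (series (exp_coeff x))).
  by apply: nondecreasing_series => n _ _; exact: exp_coeff_ge0.
exact: is_cvg_series_exp_coeff.
Qed.

(** With w the weight, |a_n| r^n <= w_n |a_n|^2 + r^(2n) / w_n, and the last
    term is dominated by an exponential series. *)
Lemma fock_abs_summable theta alpha a (r : R) :
  (fock_sqnorm theta alpha a < +oo)%E -> 0 <= r ->
  exists B : R, forall N, \sum_(0 <= n < N) normc (a n) * r ^+ n <= B.
Proof.
move=> na r0.
have [D D0 HD] := succ_powR_equiv theta (- alpha).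
pose m := (Num.truncn `|alpha|).+1.
have ma : `|alpha| <= m%:R by rewrite ltW// truncnS_gt.
have c_fin : fock_sqnorm theta alpha a \is a fin_num.
  by rewrite ge0_fin_numE// fock_sqnorm_ge0.
have hc := fock_sqnorm_leP theta alpha a (fine (fock_sqnorm theta alpha a)).
rewrite fineK// in hc; have {}hc := hc.1 (lexx _).
exists (fine (fock_sqnorm theta alpha a) + D * expR (2 ^+ m * r ^+ 2)) => N.
have x0 : 0 <= 2 ^+ m * r ^+ 2 by rewrite mulr_ge0 ?exprn_ge0.
apply: le_trans (lerD (hc N) (ler_wpM2l (ltW D0) (sum_exprn_fact_le N x0))).
rewrite mulr_sumr -big_split /=; apply: ler_sum => n _.
set w := fock_weight theta alpha n.
have w0 : 0 < w by exact: fock_weight_gt0.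
apply: (@le_trans _ _ (w * normc (a n) ^+ 2 + r ^+ n ^+ 2 / w)).
  set x := normc (a n); set y := r ^+ n.
  have x00 : 0 <= x by exact: normc_ge0.
  have y00 : 0 <= y by exact: exprn_ge0.
  rewrite -subr_ge0.
  have -> : w * x ^+ 2 + y ^+ 2 / w - x * y = ((w * x - y) ^+ 2 + w * x * y) / w.
    by field; rewrite gt_eqF.
  by rewrite divr_ge0 ?(ltW w0)// addr_ge0 ?sqr_ge0// mulr_ge0// mulr_ge0// ltW.
rewrite lerD2l.
have -> : r ^+ n ^+ 2 / w = (n%:R + theta%:num) `^ (- alpha) * r ^+ 2 ^+ n / n`!%:R.
  by rewrite /w /fock_weight invfM powRN exprAC; ring.
rewrite [leRHS]mulrA ler_wpM2r ?invr_ge0//.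
rewrite (exprMn _ (2 ^+ m)) [leRHS]mulrA ler_wpM2r ?exprn_ge0//.
apply: le_trans (HD n) _; rewrite ler_wpM2l ?(ltW D0)//.
apply: (@le_trans _ _ (n.+1%:R `^ m%:R)).
  apply: ler_powR; first by rewrite ler1n.
  by apply: le_trans ma; rewrite -normrN ler_norm.
rewrite powR_mulrn// exprAC lerXn2r ?nnegrE//.
by rewrite -natrX ler_nat ltn_expl.
Qed.

(** Every square summable coefficient sequence comes from a function of the
    Fock space. *)
Lemma fock_of_coef theta alpha a : (fock_sqnorm theta alpha a < +oo)%E ->
  exists f : fock theta alpha, taylor f = a.
Proof.
move=> na.
have [f fa fe] := entire_power_series (fun r => fock_abs_summable na (r := r)).
have fP : f \in fock_pred theta alpha by apply: mem_set; split=> //; exists a.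
have fE := taylorE fa.
exists (Fock fP).
exact: fE.
Qed.

End FockCoefficients.

(** * Compactness in the Fock space *)

Section FockCompactness.
Local Open Scope complex_scope.
Context {R : realType} (theta : {posnum R}) (beta : R).
Implicit Types (f g : fock theta beta) (c d : R) (a : nat -> R[i]).

Local Notation w := (fock_weight theta beta).

Lemma ultra_fmap (T U : Type) (h : T -> U) (F : set_system T) :
  UltraFilter F -> UltraFilter (h @ F).
Proof.
move=> FU; split=> [|G GP FG]; first exact: fmap_proper_filter.
apply/seteqP; split=> // A GA.
have [//|nA] := in_ultra_setVsetC (h @^-1` A) FU.
have GnA : G (~` A) by exact: FG.
by have := filter_ex (filterI GA GnA); case=> x [].
Qed.

Lemma ultra_cvg_bounded (T : Type) (h : T -> R) (F : set_system T) c :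
  UltraFilter F -> F [set t | `|h t| <= c] -> exists x : R, h @ F --> x.
Proof.
move=> FU Fc.
have Fh : F (h @^-1` `[- c, c]%classic).
  by apply: filterS Fc => t /=; rewrite in_itv/= ler_norml.
have := @segment_compact R (- c) c; rewrite compact_ultra.
by move=> /(_ (h @ F) (ultra_fmap h FU) Fh)[x [_ hx]]; exists x.
Qed.

Lemma taylor_fockB f g : taylor (f - g) = fun n => taylor f n - taylor g n.
Proof.
rewrite taylor_fockD -scaleN1r taylor_fockZ; apply/funext => n.
by rewrite mulN1r.
Qed.

Lemma cvg_fock_normP {T} {F : set_system T} {FF : Filter F}
    (h : T -> fock theta beta) g :
  h @ F --> g <-> forall e : R, 0 < e -> \forall t \near F, fock_norm (g - h t) < e.
Proof.
split=> [/cvgrPdist_lt H e e0|H].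
  have /H : 0 < e%:C by rewrite ltcR.
  by apply: filterS => t; rewrite ltcR.
apply/cvgrPdist_lt => e; rewrite ltcE => /andP[/eqP ei e0].
have := H _ e0; apply: filterS => t te.
have -> : e = (complex.Re e)%:C by case: e ei {e0 te} => x y /= ->.
by rewrite ltcR.
Qed.

(** The mass of the coefficients of index in [N, M[. *)
Definition fock_block a (N M : nat) : R :=
  \sum_(N <= n < M) w n * normc (a n) ^+ 2.

Lemma fock_block_ge0 a N M : 0 <= fock_block a N M.
Proof. by apply: sumr_ge0 => n _; exact: fock_term_ge0. Qed.

Lemma fock_blockB a b N M : fock_block (fun n => a n - b n) N M <=
  2 * fock_block a N M + 2 * fock_block b N M.
Proof.
rewrite /fock_block !mulr_sumr -big_split /=; apply: ler_sum => n _.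
have := le_normcD (a n) (- b n); rewrite normcN => h.
have -> : 2 * (w n * normc (a n) ^+ 2) + 2 * (w n * normc (b n) ^+ 2) =
  w n * (2 * normc (a n) ^+ 2 + 2 * normc (b n) ^+ 2) by ring.
rewrite ler_wpM2l//.
  by rewrite ltW// fock_weight_gt0.
apply: (@le_trans _ _ ((normc (a n) + normc (b n)) ^+ 2)).
  by rewrite lerXn2r ?nnegrE ?addr_ge0 ?normc_ge0.
rewrite -subr_ge0; set x := normc (a n); set y := normc (b n).
have -> : 2 * x ^+ 2 + 2 * y ^+ 2 - (x + y) ^+ 2 = (x - y) ^+ 2 by ring.
exact: sqr_ge0.
Qed.

Lemma fock_block_le_norm f N M : fock_block (taylor f) N M <= fock_norm f ^+ 2.
Proof.
have [NM|MN] := leqP N M; last first.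
  by rewrite /fock_block big_geq ?(ltnW MN)// sqr_ge0.
apply: le_trans (fock_norm_ge f M); rewrite [leRHS](big_cat_nat _ (n := N))//=.
by rewrite lerDr; apply: sumr_ge0 => n _; exact: fock_term_ge0.
Qed.

Lemma fock_block_mono a N N' M : (N <= N')%N ->
  fock_block a N' M <= fock_block a N M.
Proof.
move=> NN'; have [NM|MN] := leqP N' M; last first.
  by rewrite {1}/fock_block big_geq ?(ltnW MN)// fock_block_ge0.
rewrite [leRHS](big_cat_nat _ (n := N'))//= lerDr.
by apply: sumr_ge0 => n _; exact: fock_term_ge0.
Qed.

(** Bounded sets with uniformly small tails are compact, L being a modulus for
    the tails. Along an ultrafilter all the coefficients converge, their limits
    are the coefficients of a function of the space, and the uniform tails turn
    coefficientwise convergence into norm convergence. *)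
Lemma compact_fock_tails c (L : R -> nat) : 0 <= c ->
  compact [set g : fock theta beta | fock_norm g <= c /\
    forall d M, 0 < d -> fock_block (taylor g) (L d) M <= d].
Proof.
move=> c_ge0; rewrite compact_ultra => F FU FK.
have coefb n : F [set g : fock theta beta |
    normc (taylor g n) <= c / Num.sqrt (w n)].
  apply: filterS FK => g [gc _] /=.
  rewrite ler_pdivlMr ?sqrtr_gt0 ?fock_weight_gt0// mulrC.
  exact: le_trans (fock_coef_le g n) gc.
have coefcvg n : exists z : R[i], (fun g : fock theta beta => taylor g n) @ F --> z.
  have [x xP] : exists x : R,
      (fun g : fock theta beta => complex.Re (taylor g n)) @ F --> x.
    apply: ultra_cvg_bounded; apply: filterS (coefb n) => g.
    by apply: le_trans; exact: Re_le_normc.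
  have [y yP] : exists y : R,
      (fun g : fock theta beta => complex.Im (taylor g n)) @ F --> y.
    apply: ultra_cvg_bounded; apply: filterS (coefb n) => g.
    by apply: le_trans; exact: Im_le_normc.
  by exists (x +i* y)%C; exact: cvgc_ReIm.
have [l lP] := choice coefcvg.
have blockcvg N M : (fun g : fock theta beta =>
    fock_block (fun n => l n - taylor g n) N M) @ F --> 0.
  rewrite -[X in _ --> X](_ : \sum_(N <= n < M) w n * 0 = 0); last first.
    by rewrite big1// => i _; rewrite mulr0.
  apply: cvg_big => [|n _]; first exact: add_continuous.
  apply: cvgMr; rewrite -[X in _ --> X](expr0n R 2).
  have h : (fun g : fock theta beta => normc (l n - taylor g n)) @ F --> 0.
    apply/cvgr0Pnorm_lt => d d0.
    have /cvgc_normcP/(_ _ d0) := lP n; apply: filterS => g.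
    by rewrite ger0_norm ?normc_ge0.
  by rewrite expr2; exact: cvgM.
have lK N M b : F [set g : fock theta beta | fock_block (taylor g) N M <= b] ->
    fock_block l N M <= b.
  have h : (fun g : fock theta beta => fock_block (taylor g) N M) @ F -->
      fock_block l N M.
    apply: cvg_big => [|n _]; first exact: add_continuous.
    by apply: cvgMr; rewrite expr2; apply: cvgM; apply: cvgc_normc; exact: lP.
  exact: cvgr_to_le h.
have lc N : fock_block l 0 N <= c ^+ 2.
  apply: lK; apply: filterS FK => g [gc _] /=.
  apply: le_trans (fock_block_le_norm _ _ _) _.
  by rewrite lerXn2r ?nnegrE ?fock_norm_ge0.
have ltail d M : 0 < d -> fock_block l (L d) M <= d.
  by move=> d0; apply: lK; apply: filterS FK => g [_]; apply.
have nl : (fock_sqnorm theta beta l < +oo)%E.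
  apply: (@le_lt_trans _ _ (c ^+ 2)%:E); last exact: ltry.
  by apply/fock_sqnorm_leP => N; exact: lc.
have [g0 g0P] := fock_of_coef nl.
exists g0; split.
  split; last by move=> d M d0; rewrite g0P; exact: ltail.
  by apply: fock_norm_le => // N; rewrite g0P; exact: lc.
apply/cvg_fock_normP => d d0.
have d20 : 0 < d / 2 by rewrite divr_gt0.
have c0 : 0 < (d / 2) ^+ 2 / 8 by rewrite divr_gt0// exprn_gt0.
set N := L ((d / 2) ^+ 2 / 8).
have c20 : 0 < (d / 2) ^+ 2 / 2 by rewrite divr_gt0// exprn_gt0.
have /cvgr0Pnorm_lt/(_ _ c20) := blockcvg 0%N N.
move=> hN; near=> g; apply: (@le_lt_trans _ _ (d / 2)); last first.
  by rewrite ltr_pdivrMr//; lra.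
have gK M : fock_block (taylor g) N M <= (d / 2) ^+ 2 / 8.
  by have [_] : fock_norm g <= c /\ forall d M, 0 < d ->
    fock_block (taylor g) (L d) M <= d; [near: g|apply].
have gN : fock_block (fun n => l n - taylor g n) 0 N <= (d / 2) ^+ 2 / 2.
  apply: ltW; apply: le_lt_trans (ler_norm _) _.
  by near: g; exact: hN.
apply: fock_norm_le (ltW d20) _ => M; rewrite taylor_fockB g0P.
apply: (@le_trans _ _ (fock_block (fun n => l n - taylor g n) 0 (N + M))).
  rewrite [leRHS](big_cat_nat _ (n := M)) ?leq_addl//= lerDl.
  by apply: sumr_ge0 => i _; exact: (fock_term_ge0 _ _ (fun n => l n - taylor g n)).
rewrite /fock_block (big_cat_nat _ (n := N)) ?leq_addr//= (splitr ((d / 2) ^+ 2)).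
apply: lerD gN _; apply: le_trans (fock_blockB _ _ _ _) _.
have := ltail _ (N + M)%N c0; have := gK (N + M)%N.
set x := fock_block _ _ _; set y := fock_block _ _ _ => h1 h2; lra.
Unshelve. all: by end_near. Qed.

Lemma fock_small_tail f d : 0 < d ->
  exists L : nat, forall M, fock_block (taylor f) L M <= d.
Proof.
move=> d0; pose S := series (fun n => w n * normc (taylor f n) ^+ 2).
have S_nd : nondecreasing_seq S.
  by apply: nondecreasing_series => n _ _; exact: fock_term_ge0.
have S_cvg : cvgn S.
  apply: nondecreasing_is_cvgn => //; exists (fock_norm f ^+ 2) => _ [N _ <-].
  exact: fock_norm_ge.
have [L _ /(_ L (leqnn L)) /= HL] := (cvgrPdist_lt _ _).1 S_cvg _ d0.
exists L => M; have [LM|ML] := leqP L M; last first.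
  by rewrite /fock_block big_geq ?(ltnW ML)// ltW.
have -> : fock_block (taylor f) L M = S M - S L by rewrite sub_series_geq.
have SM := nondecreasing_cvgn_le S_nd S_cvg M.
by have := le_lt_trans (ler_norm _) HL; lra.
Qed.

(** A compact set has uniformly small tails. *)
Lemma compact_uniform_tails (K : set (fock theta beta)) d : 0 < d -> compact K ->
  exists L : nat, forall g N M, K g -> (L <= N)%N ->
    fock_block (taylor g) N M <= d.
Proof.
move=> d0 /compact_near_coveringP/(_ nat \oo
  (fun L g => forall N M, (L <= N)%N -> fock_block (taylor g) N M <= d)).
move=> /(_ _) []; last first.
  by move=> L _ /(_ L (leqnn L)) H; exists L => g N M Kg LN; exact: H.
move=> g _.
have e0 : 0 < Num.sqrt (d / 4) by rewrite sqrtr_gt0 divr_gt0.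
(* A tail that is small at g stays small near g, so that finitely many indices
   suffice by compactness. *)
have [L LP] : exists L, forall M, fock_block (taylor g) L M <= d / 4.
  by apply: fock_small_tail; rewrite divr_gt0.
have gnear : \forall g' \near g, fock_norm (g - g') < Num.sqrt (d / 4).
  have /cvg_fock_normP : id @ nbhs g --> g by exact: cvg_id.
  exact.
exists ([set g' | fock_norm (g - g') < Num.sqrt (d / 4)], [set i | (L <= i)%N]).
  by split=> //; exists L.
move=> [g' i] /= [hg' Li] N M iN.
apply: (le_trans (fock_block_mono _ _ (leq_trans Li iN))).
have -> : taylor g' = fun n => taylor g n - taylor (g - g') n.
  by apply/funext => n; rewrite taylor_fockB subKr.
apply: le_trans (fock_blockB _ _ _ _) _.
have := LP M; have : fock_block (taylor (g - g')) L M <= d / 4.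
  apply: le_trans (fock_block_le_norm _ _ _) _.
  rewrite -[leRHS]sqr_sqrtr; last by rewrite divr_ge0// ltW.
  by rewrite ler_pXn2r ?nnegrE ?fock_norm_ge0 ?sqrtr_ge0// ltW.
set x := fock_block _ _ _; set y := fock_block _ _ _; lra.
Qed.

End FockCompactness.

(** * Decay of the moments implies compactness *)

Section HilbertOperatorCompact.
Local Open Scope complex_scope.
Context {R : realType} (theta : {posnum R}).
Implicit Types (alpha beta : R) (mu : {finite_measure set R -> \bar R}).
Implicit Types (a b : nat -> R[i]).

Lemma sqrt_fock_weight alpha n : Num.sqrt (fock_weight theta alpha n) =
  (n%:R + theta%:num) `^ (alpha / 2) * Num.sqrt n`!%:R.
Proof.
rewrite /fock_weight sqrtrM ?powR_ge0//; congr (_ * _).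
by rewrite -powR12_sqrt ?powR_ge0// -powRrM.
Qed.

(** The terms of the operator in the coordinates of f with respect to the
    normalized monomials. *)
Lemma normc_hilbert_term mu alpha a n k : normc (hilbert_term mu a n k) =
  moment mu (k + n)%N * (k%:R + theta%:num) `^ (- (alpha / 2)) *
  (Num.sqrt (fock_weight theta alpha k) * normc (a k)).
Proof.
rewrite /hilbert_term !normcM !normc_real ?moment_ge0 ?sqrtr_ge0//.
rewrite sqrt_fock_weight powRN.
have w0 : 0 < (k%:R + theta%:num) `^ (alpha / 2).
  by rewrite powR_gt0// ltr_wpDl.
by field; rewrite gt_eqF.
Qed.

Lemma fock_weight_hilbert_coef mu beta a n :
  fock_weight theta beta n * normc (hilbert_coef mu a n) ^+ 2 =
  (n%:R + theta%:num) `^ beta * normc (limn (series (hilbert_term mu a n))) ^+ 2.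
Proof.
rewrite /hilbert_coef normcM normc_real ?invr_ge0 ?sqrtr_ge0//.
rewrite /fock_weight exprMn exprVn sqr_sqrtr//.
by field; rewrite pnatr_eq0 -lt0n fact_gt0.
Qed.

Lemma fock_taylor_inj alpha (f g : fock theta alpha) : taylor f = taylor g -> f = g.
Proof.
move=> fg; apply/eqP; rewrite -subr_eq0; apply/eqP; apply: fock_norm_eq0.
apply/eqP; rewrite eq_le fock_norm_ge0 andbT; apply: fock_norm_le => // N.
rewrite expr0n/= big1// => n _.
by rewrite taylor_fockB fg subrr normc0 expr0n mulr0.
Qed.

Section Bounds.
Variables (alpha beta : R) (mu : {finite_measure set R -> \bar R}).
Hypotheses (alpha1 : -1 < alpha < 1) (beta1 : -1 < beta < 1).

(** The Hilbert inequality for the rows n >= L of the operator, on finite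
    sections. *)
Lemma hilbert_rows_le : exists2 B : R, 0 < B &
  forall (C : R) (L : nat), 0 <= C ->
    (forall i, (L <= i)%N ->
       moment mu i <= C * i.+1%:R `^ (- (1 + (beta - alpha) / 2))) ->
  forall (f : fock theta alpha) (M N : nat),
  \sum_(L <= n < M) (n%:R + theta%:num) `^ beta *
    (\sum_(0 <= k < N) normc (hilbert_term mu (taylor f) n k)) ^+ 2 <=
  (C * B * fock_norm f) ^+ 2.
Proof.
have [B B0 HB] := hilbert_inequality theta alpha1 beta1.
exists B => // C L C0 HC f M N.
under eq_bigr do under eq_bigr do rewrite (normc_hilbert_term _ alpha).
set x := fun k => Num.sqrt (fock_weight theta alpha k) * normc (taylor f k).
have x0 k : 0 <= x k by rewrite mulr_ge0 ?sqrtr_ge0 ?normc_ge0.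
apply: le_trans (HB (moment mu) C L C0 (moment_ge0 mu) HC M N x x0) _.
rewrite (exprMn _ (C * B)) ler_wpM2l ?sqr_ge0//.
apply: le_trans (fock_norm_ge f N); rewrite le_eqVlt; apply/orP; left.
apply/eqP; apply: eq_bigr => k _.
by rewrite /x exprMn sqr_sqrtr// ltW// fock_weight_gt0.
Qed.

Hypothesis mu_decay : moment_decay mu (1 + (beta - alpha) / 2).

Lemma hilbert_term_cvg (f : fock theta alpha) n :
  cvgn (series (hilbert_term mu (taylor f) n)).
Proof.
have [B B0 HB] := hilbert_rows_le.
have s0 : 0 < 1 + (beta - alpha) / 2.
  by move: alpha1 beta1 => /andP[? ?] /andP[? ?]; lra.
have [C C0 HC] := moment_decay_bound s0 mu_decay.
have v0 : 0 < (n%:R + theta%:num) `^ beta by rewrite powR_gt0// ltr_wpDl.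
apply: (@cvgc_abs_series _ _
  (C * B * fock_norm f / Num.sqrt ((n%:R + theta%:num) `^ beta))) => N.
set S := \sum_(0 <= k < N) _.
have S0 : 0 <= S by apply: sumr_ge0 => k _; exact: normc_ge0.
rewrite ler_pdivlMr ?sqrtr_gt0//.
have CB0 : 0 <= C * B * fock_norm f by rewrite !mulr_ge0 ?fock_norm_ge0// ltW.
rewrite -(@ler_pXn2r _ 2)// ?nnegrE ?mulr_ge0 ?sqrtr_ge0 ?fock_norm_ge0//
  ?(ltW C0) ?(ltW B0)//.
rewrite exprMn sqr_sqrtr ?(ltW v0)//.
apply: le_trans (HB C 0%N (ltW C0) (fun i _ => HC i) f n.+1 N).
rewrite big_nat_recr//= -/S mulrC lerDr; apply: sumr_ge0 => i _.
by rewrite mulr_ge0 ?powR_ge0 ?sqr_ge0.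
Qed.

Lemma hilbert_coef_block : exists2 B : R, 0 < B &
  forall (C : R) (L : nat), 0 <= C ->
    (forall i, (L <= i)%N ->
       moment mu i <= C * i.+1%:R `^ (- (1 + (beta - alpha) / 2))) ->
  forall (f : fock theta alpha) (M : nat),
  fock_block theta beta (hilbert_coef mu (taylor f)) L M <=
    (C * B * fock_norm f) ^+ 2.
Proof.
have [B B0 HB] := hilbert_rows_le; exists B => // C L C0 HC f M.
have h : (fun N => \sum_(L <= n < M) (n%:R + theta%:num) `^ beta *
      normc (series (hilbert_term mu (taylor f) n) N) ^+ 2) @ \oo -->
    fock_block theta beta (hilbert_coef mu (taylor f)) L M.
  apply: cvg_big => [|n _]; first exact: add_continuous.
  rewrite fock_weight_hilbert_coef.
  apply: cvgMr; rewrite expr2.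
  by apply: cvgM; apply: cvgc_normc; exact: hilbert_term_cvg.
apply: (cvgr_to_le h); apply: nearW => N; apply: le_trans (HB C L C0 HC f M N).
apply: ler_sum => n _; rewrite ler_wpM2l ?powR_ge0//.
rewrite lerXn2r ?nnegrE ?normc_ge0//; last exact: ler_normc_sum.
by apply: sumr_ge0 => k _; exact: normc_ge0.
Qed.

Lemma hilbert_coefZD (k : R[i]) a b :
  (forall n, cvgn (series (hilbert_term mu a n))) ->
  (forall n, cvgn (series (hilbert_term mu b n))) ->
  hilbert_coef mu (fun n => k * a n + b n) =
  fun n => k * hilbert_coef mu a n + hilbert_coef mu b n.
Proof.
move=> ca cb; apply/funext => n; rewrite /hilbert_coef mulrCA -mulrDr.
congr (_ * _); apply: cvg_lim; first exact: norm_hausdorff.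
rewrite (_ : series _ = fun N => k * series (hilbert_term mu a n) N +
    series (hilbert_term mu b n) N).
  apply: cvgD; last exact: cb.
  by apply: cvgMr; exact: ca.
apply/funext => N; rewrite /series /= mulr_sumr -big_split /=.
by apply: eq_bigr => j _; rewrite /hilbert_term; ring.
Qed.

(** The image of a bounded set has uniformly small tails, because the constant C
    in hilbert_coef_block may be taken small when L is large. *)
Lemma moment_decay_hilbert_compact : hilbert_compact mu theta alpha beta.
Proof.
have s0 : 0 < 1 + (beta - alpha) / 2.
  by move: alpha1 beta1 => /andP[? ?] /andP[? ?]; lra.
have [B B0 HB] := hilbert_coef_block.
have [C C0 HC] := moment_decay_bound s0 mu_decay.
have /choice[T TP] : forall f : fock theta alpha, exists g : fock theta beta,
    taylor g = hilbert_coef mu (taylor f).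
  move=> f; apply: fock_of_coef.
  apply: (@le_lt_trans _ _ ((C * B * fock_norm f) ^+ 2)%:E); last exact: ltry.
  by apply/fock_sqnorm_leP => N; exact: (HB C 0%N (ltW C0) (fun i _ => HC i)).
have Tlin : linear T.
  move=> k f g; apply: fock_taylor_inj.
  rewrite TP !taylor_fockD !taylor_fockZ !TP hilbert_coefZD//;
    exact: hilbert_term_cvg.
pose Tm := GRing.isLinear.Build _ _ _ _ T Tlin.
pose TL : {linear fock theta alpha -> fock theta beta} := HB.pack T Tm.
exists TL; split.
  move=> f; split; first exact: hilbert_term_cvg.
  by rewrite -TP; exact: (fock_taylor (T f)).1.
move=> A [M [_ AM]].
pose c := `|complex.Re (M + 1)|.
have c0 : 0 <= c by exact: normr_ge0.
have Ac f : A f -> fock_norm f <= c.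
  have M1 : M < M + 1 by rewrite ltrDl.
  move=> /(AM _ M1) /=; rewrite lecE => /andP[_ h].
  exact: le_trans h (ler_norm _).
have /choice[L LP] : forall d : R, exists L : nat, 0 < d ->
    forall f, A f -> forall M', fock_block theta beta (taylor (T f)) L M' <= d.
  move=> d; have [d0|d0] := ltP 0 d; last by exists 0%N.
  (* Chosen so that (e B c)^2 <= d. *)
  pose e := Num.sqrt d / (B * (c + 1)).
  have Bc0 : 0 < B * (c + 1) by rewrite mulr_gt0// ltr_wpDl.
  have e0 : 0 < e by rewrite divr_gt0// sqrtr_gt0.
  have [L HL] := mu_decay e0; exists L => _ f Af M'.
  rewrite TP; apply: le_trans (HB e L (ltW e0) HL f M') _.
  rewrite -[leRHS](sqr_sqrtr (ltW d0)) lerXn2r ?nnegrE ?sqrtr_ge0//.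
    exact: mulr_ge0 (mulr_ge0 (ltW e0) (ltW B0)) (fock_norm_ge0 f).
  have -> : Num.sqrt d = e * (B * (c + 1)) by rewrite /e divfK// gt_eqF.
  rewrite -mulrA ler_wpM2l ?(ltW e0)// ler_wpM2l ?(ltW B0)//.
  by apply: le_trans (Ac _ Af) _; rewrite lerDl.
have CBc0 : 0 <= C * B * c by rewrite !mulr_ge0// ltW.
have cK := @compact_fock_tails R theta beta (C * B * c) L CBc0.
eexists; last first.
  split; first exact: cK.
  by apply: compact_closed => //; exact: norm_hausdorff.
move=> _ [f Af <-] /=; split; last by move=> d M' d0; exact: LP.
apply: (@le_trans _ _ (C * B * fock_norm f)).
  apply: fock_norm_le; first by rewrite !mulr_ge0 ?fock_norm_ge0// ltW.
  by move=> N; rewrite TP; exact: (HB C 0%N (ltW C0) (fun i _ => HC i)).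
by rewrite ler_wpM2l ?Ac// mulr_ge0// ltW.
Qed.

End Bounds.
End HilbertOperatorCompact.

(** * Compactness implies decay of the moments *)

Section HilbertOperatorNecessity.
Local Open Scope complex_scope.
Context {R : realType} (theta : {posnum R}).
Implicit Types (alpha beta : R) (mu : {finite_measure set R -> \bar R}).

(** In the orthonormal basis of normalized monomials, the test function has the
    coefficients N^-1/2 on [N, 2N[ and 0 elsewhere. *)
Definition block_coef alpha (N k : nat) : R :=
  if (N <= k < 2 * N)%N then
    (Num.sqrt N%:R * Num.sqrt (fock_weight theta alpha k))^-1 else 0.

Lemma block_coef_ge0 alpha N k : 0 <= block_coef alpha N k.
Proof.
by rewrite /block_coef; case: ifP => // _; rewrite invr_ge0 mulr_ge0 ?sqrtr_ge0.
Qed.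

Lemma block_fun alpha N : (0 < N)%N -> exists2 f : fock theta alpha,
  fock_norm f <= 1 & taylor f = fun k => (block_coef alpha N k)%:C.
Proof.
move=> N0.
have N0' : 0 < N%:R :> R by rewrite ltr0n.
have le1 M : \sum_(0 <= n < M) fock_weight theta alpha n *
    normc (block_coef alpha N n)%:C ^+ 2 <= 1.
  apply: (@le_trans _ _ (\sum_(0 <= n < M)
      if (N <= n < 2 * N)%N then N%:R^-1 else 0)).
    apply: ler_sum => n _; rewrite normc_real ?block_coef_ge0// /block_coef.
    case: ifP => _; last by rewrite expr0n mulr0.
    have w0 := fock_weight_gt0 theta alpha n.
    rewrite exprVn exprMn !sqr_sqrtr ?(ltW w0)// invfM mulrCA mulfV ?mulr1//.
    by rewrite gt_eqF.
  set F := fun n => if (N <= n < 2 * N)%N then N%:R^-1 else 0 : R.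
  have F0 n : 0 <= F n by rewrite /F; case: ifP => // _; rewrite invr_ge0.
  apply: (@le_trans _ _ (\sum_(0 <= n < 2 * N + M) F n)).
    by rewrite [leRHS](big_cat_nat _ (n := M)) ?leq_addl//= lerDl sumr_ge0.
  rewrite (big_cat_nat _ (n := (2 * N)%N)) ?leq_addr//=.
  rewrite (big_cat_nat _ (n := N) (p := (2 * N)%N)) ?mul2n -?addnn ?leq_addr//=.
  rewrite big_nat big1 ?add0r; last first.
    by move=> n /= nN; rewrite /F leqNgt nN.
  rewrite [X in _ + X](_ : _ = 0) ?addr0; last first.
    rewrite big_nat big1// => n /andP[nN _].
    by rewrite /F mul2n -addnn [(n < _)%N]ltnNge nN andbF.
  rewrite big_nat (eq_bigr (fun=> N%:R^-1)); last first.
    by move=> n Nn; rewrite /F mul2n -addnn Nn.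
  rewrite -big_nat sumr_const_nat addnK -[_ *+ N]mulr_natr mulVf//.
  by rewrite gt_eqF.
have [f fP] : exists f : fock theta alpha,
    taylor f = fun k => (block_coef alpha N k)%:C.
  apply: fock_of_coef; apply: (@le_lt_trans _ _ 1%:E); last exact: ltry.
  by apply/fock_sqnorm_leP.
exists f => //; apply: fock_norm_le => // M.
by rewrite fP expr1n.
Qed.

Lemma natr_powR_block (g : R) : exists2 D : R, 0 < D & forall N n : nat,
  (N <= n < 2 * N)%N -> N%:R `^ g <= D * (n%:R + theta%:num) `^ g.
Proof.
have lo0 : 0 < (2 + theta%:num)^-1 by rewrite invr_gt0 addr_gt0.
have [D D0 HD] := powR_le_of_ratio g lo0 ltr01.
exists D => // N n /andP[Nn n2N].
have N0 : (0 < N)%N by case: N Nn n2N.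
have N1 : 1 <= N%:R :> R by rewrite ler1n.
have nN : N%:R <= n%:R :> R by rewrite ler_nat.
have nN2 : n%:R <= 2 * N%:R :> R by rewrite -natrM ler_nat ltnW.
have t0 : 0 < theta%:num by [].
apply: HD.
- by rewrite ltr0n.
- by rewrite ltr_wpDl.
- rewrite mulrC ler_pdivrMr ?addr_gt0//.
  rewrite mulrDr [X in _ <= X + _]mulrC lerD// ler_peMl// ltW.
- by rewrite mul1r; apply: le_trans nN _; rewrite lerDl ltW.
Qed.

(** On the block [N, 2N[ the image of the test function has mass at least a
    constant times (m_4N N^s)^2, where m_i are the moments, because k + n <= 4N
    there; uniform smallness of tails forces this quantity to vanish. *)
Lemma hilbert_compact_moment_decay alpha beta mu : 0 < 1 + (beta - alpha) / 2 ->
  hilbert_compact mu theta alpha beta -> moment_decay mu (1 + (beta - alpha) / 2).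
Proof.
set s := 1 + (beta - alpha) / 2 => s0 [T [TP Tc]].
have [D D0 HD] := natr_powR_block beta.
have [E E0 HE] := natr_powR_block (- (alpha / 2)).
(* Coefficientwise lower bound on the block; all the terms of the series are
   nonnegative reals. *)
have lower (f : fock theta alpha) N n (m := moment mu (4 * N)) :
    (0 < N)%N -> (N <= n < 2 * N)%N ->
    taylor f = (fun k => (block_coef alpha N k)%:C) ->
    D^-1 * (m * N%:R `^ s / E) ^+ 2 / N%:R <=
    fock_weight theta beta n * normc (taylor (T f) n) ^+ 2.
  move=> N0 Nn fP.
  have N0' : 0 < N%:R :> R by rewrite ltr0n.
  have m0 : 0 <= m by exact: moment_ge0.
  have [cvgf Tf] := TP f.
  rewrite (taylorE Tf).
  rewrite fock_weight_hilbert_coef.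
  set l := limn _.
  have lge : m * N%:R `^ (1 - alpha / 2 - 2^-1) / E <= normc l.
    apply: (cvgr_to_ge (cvgc_normc (cvgf n))).
    exists (2 * N)%N => // M /= NM.
    pose tau k := normc (hilbert_term mu (taylor f) n k).
    have tauE k : hilbert_term mu (taylor f) n k = (tau k)%:C.
      rewrite /tau /hilbert_term fP; set t := (block_coef _ _ _)%:C.
      rewrite -[t]/((block_coef alpha N k)%:C) -!rmorphM normc_real//.
      by rewrite !mulr_ge0 ?moment_ge0 ?block_coef_ge0 ?sqrtr_ge0.
    have tau0 k : 0 <= tau k by exact: normc_ge0.
    have -> : normc (series (hilbert_term mu (taylor f) n) M) =
        \sum_(0 <= k < M) tau k.
      rewrite /series /=; under eq_bigr do rewrite tauE.
      by rewrite -rmorph_sum normc_real// sumr_ge0.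
    apply: (@le_trans _ _ (\sum_(N <= k < 2 * N) tau k)); last first.
      have N2 : (N <= 2 * N)%N by rewrite mul2n -addnn leq_addr.
      rewrite [leRHS](big_cat_nat _ (n := (2 * N)%N))//=.
      rewrite [X in _ <= X + _](big_cat_nat _ (n := N))//=.
      by rewrite addrAC lerDr addr_ge0// sumr_ge0.
    apply: (@le_trans _ _ (\sum_(N <= k < 2 * N)
        m * (N%:R `^ (- (alpha / 2)) / E) * N%:R `^ (- 2^-1))).
      rewrite sumr_const_nat mul2n -addnn addnK -[leRHS]mulr_natr.
      rewrite [leRHS]mulrC -[X in _ <= X * _](powRr1 (ltW N0')).
      have -> : 1 - alpha / 2 - 2^-1 = 1 + (- (alpha / 2) + - 2^-1) by ring.
      rewrite powRD ?(gt_eqF N0') ?implybT// powRD ?(gt_eqF N0') ?implybT//.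
      by rewrite le_eqVlt; apply/orP; left; apply/eqP; ring.
    rewrite !big_nat; apply: ler_sum => k Nk.
    rewrite /tau (normc_hilbert_term theta mu alpha) fP normc_real ?block_coef_ge0//.
    rewrite /block_coef Nk.
    have w0 := fock_weight_gt0 theta alpha k.
    have -> : Num.sqrt (fock_weight theta alpha k) *
        (Num.sqrt N%:R * Num.sqrt (fock_weight theta alpha k))^-1 =
        N%:R `^ (- 2^-1).
      rewrite powRN powR12_sqrt// ; field.
      by rewrite !gt_eqF ?sqrtr_gt0.
    rewrite ler_wpM2r ?powR_ge0// ler_pM ?divr_ge0 ?powR_ge0 ?(ltW E0)//.
      apply: moment_le.
      case/andP: Nk => _ k2; case/andP: Nn => _ n2; lia.
    by rewrite ler_pdivrMr// [leRHS]mulrC; exact: HE.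
  apply: (@le_trans _ _ (N%:R `^ beta / D *
      (m * N%:R `^ (1 - alpha / 2 - 2^-1) / E) ^+ 2)).
    have -> : (m * N%:R `^ s / E) ^+ 2 =
      (m * N%:R `^ (1 - alpha / 2 - 2^-1) / E) ^+ 2 * N%:R `^ beta * N%:R.
      have pD r1 r2 : N%:R `^ (r1 + r2) = N%:R `^ r1 * N%:R `^ r2 :> R.
        by rewrite powRD// (gt_eqF N0') implybT.
      have sE : N%:R `^ s * N%:R `^ s = N%:R `^ (1 - alpha / 2 - 2^-1) *
          N%:R `^ (1 - alpha / 2 - 2^-1) * N%:R `^ beta * N%:R :> R.
        rewrite -[X in _ = _ * X](powRr1 (ltW N0')) -!pD; congr (_ `^ _).
        by rewrite /s; field.
      by rewrite !exprMn !expr2 sE; ring.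
    rewrite le_eqVlt; apply/orP; left; apply/eqP; field.
    by rewrite !gt_eqF.
  apply: ler_pM => //; rewrite ?sqr_ge0 ?divr_ge0 ?powR_ge0 ?(ltW D0)//.
    by rewrite ler_pdivrMr// [leRHS]mulrC; exact: HD.
  by rewrite lerXn2r ?nnegrE ?normc_ge0// divr_ge0 ?mulr_ge0 ?powR_ge0// ltW.
have [K TK [Kc _]] : precompact (T @` [set f | fock_norm f <= 1]).
  apply: Tc; exists 1; split; first exact: real1.
  move=> x x1 f /= f1; apply: le_trans (ltW x1); rewrite -(lecR _ 1) in f1.
  exact: f1.
move=> e e0.
(* For N = n / 4 one has n + 1 <= 8 N, whence the factor 8^s. *)
pose e' := e / 8 `^ s.
have e'0 : 0 < e' by rewrite divr_gt0// powR_gt0.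
pose d := D^-1 * (e' / E) ^+ 2.
have d0 : 0 < d by rewrite mulr_gt0 ?invr_gt0// exprn_gt0// divr_gt0.
have [L HL] := compact_uniform_tails d0 Kc.
exists (4 * L.+1)%N => n Ln.
pose N := (n %/ 4)%N.
have LN : (L < N)%N by rewrite /N leq_divRL// mulnC.
have N0 : (0 < N)%N by exact: leq_trans LN.
have N0' : 0 < N%:R :> R by rewrite ltr0n.
have [f f1 fP] := block_fun alpha N0.
have := HL (T f) N (2 * N)%N _ (ltnW LN).
move=> /(_ (TK _ (ex_intro2 _ _ f f1 erefl))) hle.
have m0 : 0 <= moment mu (4 * N) by exact: moment_ge0.
have hm : moment mu (4 * N) * N%:R `^ s <= e'.
  have : D^-1 * (moment mu (4 * N) * N%:R `^ s / E) ^+ 2 <= d.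
    apply: le_trans hle; rewrite /fock_block !big_nat.
    apply: (@le_trans _ _ (\sum_(N <= n < 2 * N)
        D^-1 * (moment mu (4 * N) * N%:R `^ s / E) ^+ 2 / N%:R)).
      rewrite sumr_const_nat mul2n -addnn addnK -[leRHS]mulr_natr divfK//.
      by rewrite gt_eqF.
    rewrite big_nat; apply: ler_sum => j Nj; exact: lower.
  rewrite /d ler_pM2l ?invr_gt0// ler_pXn2r// ?nnegrE; last 2 first.
  - by rewrite divr_ge0 ?mulr_ge0 ?powR_ge0 ?(ltW E0).
  - by rewrite divr_ge0 ?(ltW E0) ?(ltW e'0).
  by rewrite ler_pM2r ?invr_gt0.
apply: (@le_trans _ _ (moment mu (4 * N))).
  by apply: moment_le; rewrite mulnC /N leq_trunc_div.
apply: (@le_trans _ _ (e' * N%:R `^ (- s))).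
  by rewrite powRN ler_pdivlMr ?powR_gt0.
rewrite /e' -mulrA ler_wpM2l ?(ltW e0)// !powRN.
rewrite -invfM lef_pV2 ?posrE ?mulr_gt0 ?powR_gt0// -powRM//.
apply: ge0_ler_powR; rewrite ?nnegrE ?(ltW s0)//.
rewrite -natrM ler_nat.
have := ltn_ceil n (isT : 0 < 4)%N; rewrite -/N; lia.
Qed.

End HilbertOperatorNecessity.

(** * The equivalence *)

Theorem theorem1p7 (R : realType) (alpha beta : R)
    (mu : {finite_measure set R -> \bar R}) :
  -1 < alpha < 1 -> -1 < beta < 1 ->
  mu (~` `[0, 1[) = 0%E ->
  forall theta : {posnum R},
    hilbert_compact mu theta alpha beta <->
    vanishing_carleson mu (1 + (beta - alpha) / 2).
Proof.
move=> alpha1 beta1 _ theta.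
have [a1 a2] := andP alpha1; have [b1 b2] := andP beta1.
have s0 : 0 < 1 + (beta - alpha) / 2 by lra.
have s2 : 1 + (beta - alpha) / 2 <= 2 by lra.
split=> [/(hilbert_compact_moment_decay s0)|].
  exact: moment_decay_vanishing_carleson.
move/(vanishing_carleson_moment_decay s0 s2).
exact: moment_decay_hilbert_compact.
Qed.
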